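(* Let $Q(x_1,x_2,x_3)$ be an integral quadratic form of signature $(2,1)$ and let $\|\cdot\|$ be a norm on $\mathbb{R}^3$. Suppose that for some $v_0\in\mathbb{Z}^3$ with $Q(v_0)>0$, the stabilizer subgroup of $v_0$ is isotropic over $\mathbb{Q}$. Then there exists $c=c(\|\cdot\|)>0$ such that, as $T\to\infty$, $$\#\{x\in\mathbb{Z}^3: Q(x)=Q(v_0),\ \|x\|<T\}\sim c\cdot T\log T.$$
   Context: The stabilizer of $v_0$ is taken in the special orthogonal group $\mathrm{SO}_Q$, viewed as an algebraic group over $\mathbb{Q}$; ''isotropic over $\mathbb{Q}$'' means that it contains a non-trivial $\mathbb{Q}$-split torus. The constant $c$ may depend on $Q$ and $v_0$ as well as on the norm. *)

(* Defs.v *)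
From HB Require Import structures.
From mathcomp Require Import all_boot all_order all_algebra.
From mathcomp Require mpoly.
From mathcomp Require Import finmap.
From mathcomp Require Import all_classical all_reals all_analysis.
Import Order.TTheory GRing.Theory Num.Theory.
Import numFieldNormedType.Exports.

Set Implicit Arguments.
Unset Strict Implicit.
Unset Printing Implicit Defensive.

Local Open Scope ring_scope.

(* "Integral" means integer coefficients, i.e. integer values on Z^3; the
   Gram matrix of the form may have half-integral off-diagonal entries.
   Only the entries a i j with i <= j are used. *)
Definition qform (a : 'M[int]_3) (A : comNzRingType) (x : 'cV[A]_3) : A :=
  \sum_(i < 3) \sum_(j < 3 | (i <= j)%N) (a i j)%:~R * x i 0 * x j 0.

Definition int_vec (A : nzRingType) (x : 'cV[int]_3) : 'cV[A]_3 :=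
  map_mx (fun z : int => z%:~R) x.

Definition signature_2_1 (R : realType) (a : 'M[int]_3) : Prop :=
  exists2 P : 'M[R]_3, P \in unitmx &
    forall y : 'cV[R]_3,
      qform a (P *m y) = y 0 0 ^+ 2 + y 1 0 ^+ 2 - y 2%:R 0 ^+ 2.

(* Algebraic groups over Q are given by their functors of points on
   commutative Q-algebras; subgroups of GL_3 are families of sets of
   3 x 3 matrices. *)
Definition matrix_functor := forall A : comUnitAlgType rat, 'M[A]_3 -> Prop.

(* Since 2 is invertible in A, invariance of the values of Q on A^3 is
   invariance of Q as a form over A. *)
Definition SO_Q (a : 'M[int]_3) : matrix_functor := fun A g =>
  \det g = 1 /\ forall x : 'cV[A]_3, qform a (g *m x) = qform a x.

Definition stabilizer (a : 'M[int]_3) (v : 'cV[int]_3) : matrix_functor :=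
  fun A g => SO_Q a g /\ g *m int_vec A v = int_vec A v.

(* Polynomials in the nine matrix entries suffice to define closed
   subschemes of SO_Q, where the determinant is 1. *)
Definition vanishes_at (A : comUnitAlgType rat) (p : mpoly.mpoly (3 * 3) rat)
    (g : 'M[A]_3) : Prop :=
  mpoly.mmap (in_alg A) (mxvec g 0) p = 0.

Record closed_subgroup (G H : matrix_functor) : Prop := ClosedSubgroup {
  closed_subgroup_eqs : exists I : mpoly.mpoly (3 * 3) rat -> Prop,
    forall (A : comUnitAlgType rat) (g : 'M[A]_3),
      H A g <-> G A g /\ forall p, I p -> vanishes_at p g;
  closed_subgroup1 : forall A : comUnitAlgType rat, H A 1%:M;
  closed_subgroupM : forall (A : comUnitAlgType rat) (g h : 'M[A]_3),
    H A g -> H A h -> H A (g *m h);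
  closed_subgroupV : forall (A : comUnitAlgType rat) (g : 'M[A]_3),
    H A g -> H A (invmx g) }.

Definition Gm_pow (k : nat) (A : comUnitAlgType rat) (t : 'I_k -> A) : Prop :=
  forall i, t i \is a GRing.unit.

(* phi is an isomorphism of group functors from (G_m)^k to H; by Yoneda's
   lemma, natural transformations are the same as morphisms over Q. *)
Record split_torus_iso (k : nat) (H : matrix_functor)
    (phi : forall A : comUnitAlgType rat, ('I_k -> A) -> 'M[A]_3) : Prop :=
  SplitTorusIso {
  torus_iso_im : forall (A : comUnitAlgType rat) (t : 'I_k -> A),
    Gm_pow t -> H A (phi A t);
  torus_iso_morph : forall (A : comUnitAlgType rat) (s t : 'I_k -> A),
    Gm_pow s -> Gm_pow t ->
    phi A (fun i => s i * t i) = phi A s *m phi A t;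
  torus_iso_natural : forall (A B : comUnitAlgType rat)
      (f : {lrmorphism A -> B}) (t : 'I_k -> A),
    Gm_pow t -> phi B (fun i => f (t i)) = map_mx f (phi A t);
  torus_iso_inj : forall (A : comUnitAlgType rat) (s t : 'I_k -> A),
    Gm_pow s -> Gm_pow t -> phi A s = phi A t -> s = t;
  torus_iso_surj : forall (A : comUnitAlgType rat) (g : 'M[A]_3),
    H A g -> exists2 t : 'I_k -> A, Gm_pow t & phi A t = g }.

Definition Q_isotropic (G : matrix_functor) : Prop :=
  exists (H : matrix_functor) (k : nat)
         (phi : forall A : comUnitAlgType rat, ('I_k -> A) -> 'M[A]_3),
    [/\ closed_subgroup G H, (0 < k)%N & split_torus_iso H phi].

Record is_norm (R : realType) (N : 'cV[R]_3 -> R) : Prop := IsNorm {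
  norm_triangle : forall x y, N (x + y) <= N x + N y;
  norm_homogeneous : forall (r : R) x, N (r *: x) = `|r| * N x;
  norm_definite : forall x, N x = 0 -> x = 0 }.

Local Open Scope classical_set_scope.

Definition level_points (R : realType) (a : 'M[int]_3) (v0 : 'cV[int]_3)
    (N : 'cV[R]_3 -> R) (T : R) : set 'cV[int]_3 :=
  [set x | qform a x = qform a v0 /\ N (int_vec R x) < T].

(* level_points is finite when N is a norm, so that fset_set, which is
   empty on infinite sets, computes the actual cardinality. *)
Definition count_points (R : realType) (a : 'M[int]_3) (v0 : 'cV[int]_3)
    (N : 'cV[R]_3 -> R) (T : R) : nat :=
  #|` fset_set (level_points a v0 N T)|%fset.

(* Main.v *)
Require Import Defs.
From HB Require Import structures.
From mathcomp Require Import all_boot all_order all_algebra.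
From mathcomp Require Import complex finmap.
From mathcomp Require Import all_classical all_reals all_analysis.
From mathcomp Require Import ring lra zify.
Import Order.TTheory GRing.Theory Num.Theory.
Import numFieldNormedType.Exports.

Set Implicit Arguments.
Unset Strict Implicit.
Unset Printing Implicit Defensive.

Local Open Scope classical_set_scope.
Local Open Scope ring_scope.

(** Why the count grows like T log T.

The stabilizer of v0 is the special orthogonal group of the restriction of Q
to the plane orthogonal to v0.  If it contains a split torus, that plane has a
rational isotropic line ([stabilizer_isotropic_vector]), so it is a hyperbolic
plane, and in suitable rational coordinates the equation Q(x) = Q(v0) reads
Z^2 - X Y = M^2 ([hyperbolic_parametrization]).  This says that the integral
matrix with rows (X, Z + M) and (Z - M, Y) is singular.  It is not zero, so it
is p u^T with p a primitive vector, and (p, u) is unique up to a common sign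
([rank_one_factorization], [rank_one_unique]).  The points of the level set
thus become the pairs (p, u) with det (p, u) = 2 M =: D, subject to
congruences modulo a fixed K; the vector x is, up to the linear change of
coordinates, the symmetric product p.u of p and u.

Fix p.  The vectors u with det (p, u) = D form a line u0 + Z p, and the
corresponding points x form a progression of direction p.p.  Hence the number
of those of norm less than T is 2 T w(p) / (K nu(p)) + O(1), where nu(p) is the
norm of p.p and where w(p), the number of admissible residues of u, depends
only on p modulo K ([fiber_count]).  The bound O(1) is good enough as long as
|p| <= sqrt T, since it then contributes O(T).  The points with a larger p are
reached by symmetry: x and -x have, up to a bounded factor, p and u exchanged,
and |p| |u| = O(T).  So, up to a set of points with both |p| and |u| of order
at most sqrt T, exactly one of x and -x satisfies |p| <= sqrt T
([height_duality]), and that set has only O(T) elements ([thin_count]).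

There remains the sum of w(p) / nu(p) over the primitive p with
|p| <= sqrt T.  Since nu is homogeneous of degree 2, the vectors of sup norm n
contribute 1 / n times a Riemann sum of mesh 1 / n for a positive Lipschitz
function, and summing over n produces the logarithm; residue classes modulo K
all get the same share.  Passing from all vectors to primitive ones is done by
sorting the vectors of a class by their gcd, which expresses the full sum in
terms of the primitive sums for smaller bounds, and by solving this recursion
by induction ([sector_sum_coprime]).  The class of v0 itself is admissible,
whence the constant is positive. *)

(** * The quadratic form and its polar form *)

Definition bform (a : 'M[int]_3) (A : comNzRingType) (x y : 'cV[A]_3) : A :=
  qform a (x + y) - qform a x - qform a y.

Lemma qformE (a : 'M[int]_3) (A : comNzRingType) (x : 'cV[A]_3) :
  qform a x =
    (a 0 0)%:~R * x 0 0 * x 0 0 + (a 0 1)%:~R * x 0 0 * x 1 0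
    + (a 0 2%:R)%:~R * x 0 0 * x 2%:R 0 + (a 1 1)%:~R * x 1 0 * x 1 0
    + (a 1 2%:R)%:~R * x 1 0 * x 2%:R 0
    + (a 2%:R 2%:R)%:~R * x 2%:R 0 * x 2%:R 0.
Proof.
rewrite /qform !big_ord_recl big_ord0 addr0.
rewrite !(big_mkcond (fun j : 'I_3 => leq _ _)) /=.
rewrite !big_ord_recl !big_ord0 /= !addr0 !add0r.
have -> : lift ord0 ord0 = 1 :> 'I_3 by apply/val_inj.
have -> : lift ord0 (lift ord0 ord0) = 2%:R :> 'I_3 by apply/val_inj.
have -> : ord0 = 0 :> 'I_3 by apply/val_inj.
by rewrite !addrA.
Qed.

Lemma bformE (a : 'M[int]_3) (A : comNzRingType) (x y : 'cV[A]_3) :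
  bform a x y =
    (a 0 0)%:~R * (2%:R * x 0 0 * y 0 0)
    + (a 0 1)%:~R * (x 0 0 * y 1 0 + x 1 0 * y 0 0)
    + (a 0 2%:R)%:~R * (x 0 0 * y 2%:R 0 + x 2%:R 0 * y 0 0)
    + (a 1 1)%:~R * (2%:R * x 1 0 * y 1 0)
    + (a 1 2%:R)%:~R * (x 1 0 * y 2%:R 0 + x 2%:R 0 * y 1 0)
    + (a 2%:R 2%:R)%:~R * (2%:R * x 2%:R 0 * y 2%:R 0).
Proof. by rewrite /bform !qformE !mxE; ring. Qed.

Lemma qformD a (A : comNzRingType) (x y : 'cV[A]_3) :
  qform a (x + y) = qform a x + qform a y + bform a x y.
Proof. by rewrite /bform; ring. Qed.

Lemma qformZ a (A : comNzRingType) (k : A) (x : 'cV[A]_3) :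
  qform a (k *: x) = k ^+ 2 * qform a x.
Proof. by rewrite !qformE !mxE; ring. Qed.

Lemma bformC a (A : comNzRingType) (x y : 'cV[A]_3) : bform a x y = bform a y x.
Proof. by rewrite !bformE; ring. Qed.

Lemma bformDl a (A : comNzRingType) (x y z : 'cV[A]_3) :
  bform a (x + y) z = bform a x z + bform a y z.
Proof. by rewrite !bformE !mxE; ring. Qed.

Lemma bformZl a (A : comNzRingType) (k : A) (x z : 'cV[A]_3) :
  bform a (k *: x) z = k * bform a x z.
Proof. by rewrite !bformE !mxE; ring. Qed.

Lemma bformDr a (A : comNzRingType) (x y z : 'cV[A]_3) :
  bform a z (x + y) = bform a z x + bform a z y.
Proof. by rewrite !(bformC a z) bformDl. Qed.

Lemma bformZr a (A : comNzRingType) (k : A) (x z : 'cV[A]_3) :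
  bform a z (k *: x) = k * bform a z x.
Proof. by rewrite !(bformC a z) bformZl. Qed.

Lemma bformxx a (A : comNzRingType) (x : 'cV[A]_3) :
  bform a x x = 2%:R * qform a x.
Proof. by rewrite bformE qformE; ring. Qed.

Lemma qform_map a (A B : comNzRingType) (f : {rmorphism A -> B}) (x : 'cV[A]_3) :
  qform a (map_mx f x) = f (qform a x).
Proof. by rewrite !qformE !mxE !(rmorphD, rmorphM, rmorph_int). Qed.

Lemma bform_map a (A B : comNzRingType) (f : {rmorphism A -> B}) (x y : 'cV[A]_3) :
  bform a (map_mx f x) (map_mx f y) = f (bform a x y).
Proof. by rewrite /bform -map_mxD !qform_map !rmorphB. Qed.

Lemma map_int_vec (A B : comNzRingType) (f : {rmorphism A -> B}) (x : 'cV[int]_3) :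
  map_mx f (int_vec A x) = int_vec B x.
Proof. by apply/matrixP=> i j; rewrite !mxE rmorph_int. Qed.

Lemma qform_int_vec a (A : comNzRingType) (x : 'cV[int]_3) :
  qform a (int_vec A x) = (qform a x)%:~R.
Proof. exact: (qform_map a (intr : {rmorphism int -> A})). Qed.

Lemma bform_int_vec a (A : comNzRingType) (x y : 'cV[int]_3) :
  bform a (int_vec A x) (int_vec A y) = (bform a x y)%:~R.
Proof. exact: (bform_map a (intr : {rmorphism int -> A})). Qed.

Lemma cV_common_denominator (x : 'cV[rat]_3) :
  exists2 d : int, d != 0 & exists y : 'cV[int]_3, int_vec rat y = d%:~R *: x.
Proof.
pose d := denq (x 0 0) * denq (x 1 0) * denq (x 2%:R 0).
exists d; first by rewrite !mulf_neq0 ?denq_neq0.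
have hq (i : 'I_3) : (denq (x i 0))%:~R * x i 0 = (numq (x i 0))%:~R.
  by rewrite mulrC -numqE.
exists (\col_i (if i == 0 then numq (x 0 0) * denq (x 1 0) * denq (x 2%:R 0)
  else if i == 1 then denq (x 0 0) * numq (x 1 0) * denq (x 2%:R 0)
  else denq (x 0 0) * denq (x 1 0) * numq (x 2%:R 0))).
apply/matrixP=> i j; rewrite (ord1 j) !mxE /d.
case: (eqVneq i 0) => [->|i0]; first by rewrite !intrM -(hq 0); ring.
case: (eqVneq i 1) => [->|i1]; first by rewrite !intrM -(hq 1); ring.
have -> : i = 2%:R.
  apply/val_inj; move: i0 i1; rewrite -!val_eqE /=.
  by case: (i : nat) (ltn_ord i) => [|[|[|]]].
by rewrite !intrM -(hq 2%:R); ring.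
Qed.

(** * A rational isotropic vector orthogonal to v0 *)

HB.instance Definition _ :=
  GRing.Lalgebra_isComAlgebra.Build rat (Rcomplex rat).

Definition gauss_conj (z : Rcomplex rat) : Rcomplex rat :=
  Complex (complex.Re z) (- complex.Im z).

Lemma gauss_conj_linear : linear gauss_conj.
Proof. by move=> k [a b] [c d]; congr Complex => /=; rewrite /= opprD mulrN. Qed.

Lemma gauss_conj_monoid_morphism : monoid_morphism gauss_conj.
Proof.
split; first by rewrite /gauss_conj /= oppr0.
by move=> [a b] [c d]; congr Complex => /=; rewrite ?mulrNN // mulrN mulNr opprD.
Qed.

HB.instance Definition _ := GRing.isLinear.Build
  rat (Rcomplex rat) (Rcomplex rat) _ gauss_conj gauss_conj_linear.
HB.instance Definition _ := GRing.isMonoidMorphism.Build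
  (Rcomplex rat) (Rcomplex rat) gauss_conj gauss_conj_monoid_morphism.

Definition mxRe m n (g : 'M[Rcomplex rat]_(m, n)) : 'M[rat]_(m, n) :=
  map_mx (@complex.Re rat) g.
Definition mxIm m n (g : 'M[Rcomplex rat]_(m, n)) : 'M[rat]_(m, n) :=
  map_mx (@complex.Im rat) g.

Lemma Re_sum n (F : 'I_n -> Rcomplex rat) :
  complex.Re (\sum_i F i) = \sum_i complex.Re (F i).
Proof.
elim/big_rec2: _ => [//|i x y _ <-]; by case: (F i) y => [? ?] [? ?].
Qed.

Lemma Im_sum n (F : 'I_n -> Rcomplex rat) :
  complex.Im (\sum_i F i) = \sum_i complex.Im (F i).
Proof.
elim/big_rec2: _ => [//|i x y _ <-]; by case: (F i) y => [? ?] [? ?].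
Qed.

Lemma mxReM m n p (g : 'M[Rcomplex rat]_(m, n)) (h : 'M[Rcomplex rat]_(n, p)) :
  mxRe (g *m h) = mxRe g *m mxRe h - mxIm g *m mxIm h.
Proof.
apply/matrixP=> i j; rewrite !mxE Re_sum -sumrB; apply: eq_bigr => k _.
by rewrite !mxE; case: (g i k) (h k j) => [? ?] [? ?].
Qed.

Lemma mxImM m n p (g : 'M[Rcomplex rat]_(m, n)) (h : 'M[Rcomplex rat]_(n, p)) :
  mxIm (g *m h) = mxRe g *m mxIm h + mxIm g *m mxRe h.
Proof.
apply/matrixP=> i j; rewrite !mxE Im_sum -big_split; apply: eq_bigr => k _.
by rewrite !mxE; case: (g i k) (h k j) => [? ?] [? ?].
Qed.

Lemma mx_ReIm m n (g h : 'M[Rcomplex rat]_(m, n)) :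
  mxRe g = mxRe h -> mxIm g = mxIm h -> g = h.
Proof.
move=> /matrixP hr /matrixP hi; apply/matrixP=> i j.
move: (hr i j) (hi i j); rewrite !mxE.
by case: (g i j) (h i j) => [? ?] [? ?] /= -> ->.
Qed.

Lemma mxRe_1 n : mxRe (1%:M : 'M[Rcomplex rat]_n) = 1%:M.
Proof. by apply/matrixP=> i j; rewrite !mxE; case: (i == j). Qed.

Lemma mxIm_1 n : mxIm (1%:M : 'M[Rcomplex rat]_n) = 0.
Proof. by apply/matrixP=> i j; rewrite !mxE; case: (i == j). Qed.

Lemma mxRe_conj m n (g : 'M[Rcomplex rat]_(m, n)) : mxRe (map_mx gauss_conj g) = mxRe g.
Proof. by apply/matrixP=> i j; rewrite !mxE. Qed.

Lemma mxIm_conj m n (g : 'M[Rcomplex rat]_(m, n)) : mxIm (map_mx gauss_conj g) = - mxIm g.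
Proof. by apply/matrixP=> i j; rewrite !mxE. Qed.

Lemma mxRe_alg m n (x : 'M[rat]_(m, n)) :
  mxRe (map_mx (in_alg (Rcomplex rat)) x) = x.
Proof. by apply/matrixP=> i j; rewrite !mxE /= mulr1. Qed.

Lemma mxIm_alg m n (x : 'M[rat]_(m, n)) :
  mxIm (map_mx (in_alg (Rcomplex rat)) x) = 0.
Proof. by apply/matrixP=> i j; rewrite !mxE /= mulr0. Qed.

Definition gauss_i : Rcomplex rat := Complex 0 1.

Lemma mxRe_scale_i m n (c : rat) (x : 'M[rat]_(m, n)) :
  mxRe ((c *: gauss_i) *: map_mx (in_alg (Rcomplex rat)) x) = 0.
Proof.
apply/matrixP=> i j; rewrite !mxE.
suff: complex.Re (c *: gauss_i * in_alg (Rcomplex rat) (x i j)) = 0 by [].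
by rewrite /= !mulr0 mul0r subr0.
Qed.

Lemma mxIm_scale_i m n (c : rat) (x : 'M[rat]_(m, n)) :
  mxIm ((c *: gauss_i) *: map_mx (in_alg (Rcomplex rat)) x) = c *: x.
Proof.
apply/matrixP=> i j; rewrite !mxE.
suff: complex.Im (c *: gauss_i * in_alg (Rcomplex rat) (x i j)) = c * x i j by [].
by rewrite /= !(mulr0, mulr1, add0r, mul0r).
Qed.

Lemma gauss_iK (c : rat) : (c *: gauss_i) ^+ 2 = in_alg (Rcomplex rat) (- c ^+ 2).
Proof.
rewrite expr2; congr Complex => /=; rewrite ?mulr0 ?mul0r ?addr0 //.
by rewrite !mulr1 sub0r expr2.
Qed.

Lemma gauss_i_unit : gauss_i \is a GRing.unit.
Proof. by rewrite unitfE. Qed.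

(** With g = C + i Y these hypotheses express that the conjugate of g is its
    inverse and that g^4 = 1.  They give Y^3 = Y, so the rational matrix Y has
    an eigenvector for the eigenvalue 1 or -1, which C then kills: it spans a
    rational eigenline of g. *)
Lemma rational_eigenvector n (C Y : 'M[rat]_n) :
  C *m C + Y *m Y = 1%:M -> C *m Y = 0 -> Y *m C = 0 -> Y != 0 ->
  exists (e : 'cV[rat]_n) (c : rat),
    [/\ e != 0, c ^+ 2 = 1, C *m e = 0 & Y *m e = c *: e].
Proof.
move=> CCYY CY YC Y0.
have Y3 : Y *m (Y *m Y) = Y.
  by rewrite -[RHS]mulmx1 -CCYY mulmxDr [Y *m (C *m C)]mulmxA YC mul0mx add0r.
have [k Yk] : exists k, col k Y != 0.
  apply/existsP; apply: contraNT Y0 => /existsPn H; apply/eqP/matrixP=> i j.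
  have /negPn/eqP/matrixP/(_ i 0) := H j; by rewrite !mxE.
pose w := Y *m delta_mx k 0 : 'cV[rat]_n; rewrite colE -/w in Yk.
have YYw : Y *m (Y *m w) = w by rewrite /w !mulmxA -(mulmxA Y Y Y) Y3.
have Cw : C *m w = 0 by rewrite /w mulmxA CY mul0mx.
have [sw0|sw0] := eqVneq (Y *m w + w) 0.
  exists w, (-1); split; rewrite ?sqrrN ?expr1n // scaleN1r.
  by apply/eqP; rewrite -subr_eq0 opprK sw0.
exists (Y *m w + w), 1; split; rewrite ?expr1n //.
  by rewrite mulmxDr Cw mulmxA CY mul0mx addr0.
by rewrite mulmxDr YYw scale1r addrC.
Qed.

(** The vector e satisfies g e = c i e with (c i)^2 = -1, so invariance of Q
    gives Q(e) = -Q(e), and invariance of Q at e + v gives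
    c i B(e, v) = B(e, v) with B(e, v) rational. *)
Lemma isotropic_eigenvector a (v : 'cV[rat]_3) (g : 'M[Rcomplex rat]_3)
    (e : 'cV[rat]_3) (c : rat) :
  (forall x : 'cV[Rcomplex rat]_3, qform a (g *m x) = qform a x) ->
  g *m map_mx (in_alg (Rcomplex rat)) v = map_mx (in_alg (Rcomplex rat)) v ->
  c ^+ 2 = 1 -> mxRe g *m e = 0 -> mxIm g *m e = c *: e ->
  qform a e = 0 /\ bform a e v = 0.
Proof.
move=> gQ gv c2 ge0 gec.
set al := in_alg (Rcomplex rat) in gv *.
have ge : g *m map_mx al e = (c *: gauss_i) *: map_mx al e.
  apply: mx_ReIm; first by rewrite mxReM mxRe_alg mxIm_alg mulmx0 subr0 mxRe_scale_i.
  by rewrite mxImM mxRe_alg mxIm_alg mulmx0 add0r mxIm_scale_i.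
have Qe0 : qform a e = 0.
  have := gQ (map_mx al e); rewrite ge qformZ gauss_iK c2 qform_map -rmorphM.
  by move/fmorph_inj; lra.
split=> //.
have := gQ (map_mx al e + map_mx al v).
rewrite mulmxDr ge gv !qformD qformZ bformZl !qform_map bform_map Qe0 rmorph0 mulr0.
rewrite !add0r => /addrI.
rewrite /al => /(congr1 (@complex.Re rat)) /=.
by rewrite !(mulr0, mulr1, mul0r, subr0).
Qed.

(** The 4-torsion of a one-dimensional torus that does not split is a
    nontrivial twist of the group of fourth roots of unity, so the points of
    order 4 suffice to see the splitting.  The image g of the point i of G_m under a parametrization
    over Q satisfies g^4 = 1 and g^2 <> 1, and by naturality its complex
    conjugate is the image of -i, that is, the inverse of g.  Hence the
    eigenlines of g for i and -i are stable under conjugation. *)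
Lemma stabilizer_isotropic_vector a (v0 : 'cV[int]_3) :
  Q_isotropic (stabilizer a v0) ->
  exists e : 'cV[int]_3, [/\ e != 0, qform a e = 0 & bform a e v0 = 0].
Proof.
move=> [H [k [phi [cs k0 iso]]]]; have [I HI] := closed_subgroup_eqs cs.
case: iso => im mor nat inj _.
pose A : comUnitAlgType rat := Rcomplex rat.
pose t (z : A) : 'I_k -> A := fun _ => z.
have tu (z : A) : z \is a GRing.unit -> Gm_pow (t z) by move=> u j.
have stab (z : A) : z \is a GRing.unit -> stabilizer a v0 (phi A (t z)).
  move=> uz; have [HG _] := HI A (phi A (t z)).
  by have [] := HG (im A (t z) (tu z uz)).
have phiM (y z : A) : y \is a GRing.unit -> z \is a GRing.unit ->
    phi A (t (y * z)) = phi A (t y) *m phi A (t z).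
  by move=> uy uz; exact: mor.
have phi1 : phi A (t 1) = 1%:M.
  have u : phi A (t 1) \in unitmx.
    by rewrite unitmxE; have [[-> _] _] := stab 1 (unitr1 _); exact: unitr1.
  have := phiM 1 1 (unitr1 _) (unitr1 _); rewrite mulr1 => h.
  by rewrite -[LHS]mulmx1 -[in LHS](mulmxV u) mulmxA -h mulmxV.
pose i : A := gauss_i; pose ui : i \is a GRing.unit := gauss_i_unit.
have uN (z : A) : z \is a GRing.unit -> - z \is a GRing.unit by rewrite unitrN.
have ii : i * i = -1.
  by congr Complex => /=; rewrite ?mulr0 ?mul0r ?mulr1 ?add0r ?addr0 ?oppr0.
pose g := phi A (t i); pose g' := phi A (t (- i)).
have gg' : g *m g' = 1%:M by rewrite -phiM ?uN // mulrN ii opprK phi1.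
have g'g : g' *m g = 1%:M by rewrite -phiM ?uN // mulNr ii opprK phi1.
have g2 : g *m g = g' *m g' by rewrite -!phiM ?uN // mulrNN.
have gconj : g' = map_mx gauss_conj g.
  rewrite /g' /g -(nat A A gauss_conj); last exact: tu.
  congr phi; apply/funext => j; rewrite /t; congr Complex; exact: oppr0.
have gne : g != g'.
  apply: contra_eq_neq ii => /(inj A _ _ (tu _ ui) (tu _ (uN _ ui))) h.
  have /(congr1 (@complex.Im rat)) := congr1 (fun f => f (Ordinal k0)) h.
  by rewrite /t /=; lra.
(* Everything below takes place over the rationals: g = C + i Y. *)
pose C := mxRe g; pose Y := mxIm g.
have Cg' : mxRe g' = C by rewrite gconj mxRe_conj.
have Yg' : mxIm g' = - Y by rewrite gconj mxIm_conj.
have CCYY : C *m C + Y *m Y = 1%:M.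
  by rewrite -mxRe_1 -gg' mxReM Cg' Yg' mulmxN opprK.
have comm : Y *m C = C *m Y.
  have := congr1 (@mxIm 3 3) gg'; rewrite mxImM Cg' Yg' mxIm_1 mulmxN.
  by move/eqP; rewrite addrC subr_eq0 => /eqP.
have CY : C *m Y = 0.
  have := congr1 (@mxIm 3 3) g2; rewrite !mxImM Cg' Yg' mulmxN mulNmx comm.
  rewrite -/C -/Y; move: (C *m Y) => Z /matrixP h; apply/matrixP=> p q.
  by have := h p q; rewrite !mxE; lra.
have Y0 : Y != 0.
  apply: contra gne => /eqP Y0; apply/eqP/mx_ReIm; first by rewrite Cg'.
  by rewrite Yg' -/Y Y0 oppr0.
have YC : Y *m C = 0 by rewrite comm.
have [e [c [e0 c2 Ce Ye]]] := rational_eigenvector CCYY CY YC Y0.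
have [[_ gQ] gv] := stab i ui.
rewrite -(map_int_vec (in_alg A : {rmorphism rat -> A})) in gv.
have [Qe Be] := isotropic_eigenvector gQ gv c2 Ce Ye.
have [d d0 [e' He']] := cV_common_denominator e.
exists e'; split.
- apply: contra e0 => /eqP e'0; move: He'; rewrite e'0 => /esym/eqP.
  rewrite /int_vec map_mx0 scaler_eq0 intr_eq0 (negPf d0) //.
- by apply/eqP; rewrite -(intr_eq0 rat) -qform_int_vec He' qformZ Qe mulr0.
- by apply/eqP; rewrite -(intr_eq0 rat) -bform_int_vec He' bformZl Be mulr0.
Qed.

(** * Hyperbolic coordinates on the level set *)

Lemma cV3P (A : nzRingType) (x y : 'cV[A]_3) :
  x 0 0 = y 0 0 -> x 1 0 = y 1 0 -> x 2%:R 0 = y 2%:R 0 -> x = y.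
Proof.
move=> h0 h1 h2; apply/matrixP=> i j; rewrite (ord1 j).
have [->|i0] := eqVneq i 0 => //; have [->|i1] := eqVneq i 1 => //.
have -> // : i = 2%:R.
apply/val_inj; move: i0 i1; rewrite -!val_eqE /=.
by case: (i : nat) (ltn_ord i) => [|[|[|]]].
Qed.

(** In real coordinates where Q = y0^2 + y1^2 - y2^2, pairing y with its mirror
    image (y0, y1, -y2) gives twice the Euclidean square of y. *)
Lemma bform_nondegenerate (R : realType) a (e : 'cV[int]_3) :
  signature_2_1 R a -> e != 0 -> exists t : 'cV[int]_3, bform a e t != 0.
Proof.
move=> [P uP HP] e0; apply/not_existsP => Ht.
have {}Ht t : bform a e t = 0 by have /negP/negPn/eqP := Ht t.
have BR (z : 'cV[R]_3) : bform a (int_vec R e) z = 0.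
  have -> : bform a (int_vec R e) z =
      z 0 0 * bform a (int_vec R e) (int_vec R (delta_mx 0 0))
    + z 1 0 * bform a (int_vec R e) (int_vec R (delta_mx 1 0))
    + z 2%:R 0 * bform a (int_vec R e) (int_vec R (delta_mx 2%:R 0)).
    by rewrite !bformE !mxE /=; ring.
  by rewrite !bform_int_vec !Ht; ring.
have [y Py] : exists y, P *m y = int_vec R e.
  by exists (invmx P *m int_vec R e); rewrite mulmxA mulmxV // mul1mx.
pose z : 'cV[R]_3 := \col_i (if i == 2%:R then - y i 0 else y i 0).
have := BR (P *m z).
rewrite -Py /bform -mulmxDr !HP !mxE /= => h.
have {h} hy : y 0 0 ^+ 2 + y 1 0 ^+ 2 + y 2%:R 0 ^+ 2 = 0 by lra.
have hs i : 0 <= y i 0 ^+ 2 := sqr_ge0 _.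
have y0 i : y i 0 ^+ 2 = 0 -> y i 0 = 0 by move/eqP; rewrite sqrf_eq0 => /eqP.
have : y = 0.
  by apply: cV3P; rewrite mxE; apply: y0;
    have := hs 0; have := hs 1; have := hs 2%:R; lra.
move=> yz; move: Py; rewrite yz mulmx0 => /matrixP e00.
move/negP: e0; apply; apply/eqP/matrixP => i j.
by have := e00 i j; rewrite !mxE => /esym/eqP; rewrite intr_eq0 => /eqP.
Qed.

(** A vector t not orthogonal to e is first made orthogonal to v0, then
    isotropic by subtracting a multiple of e.  The scaling of E by the value
    -Q(v0) makes the ternary form proportional to Z^2 - n^2 X Y. *)
Lemma hyperbolic_frame (R : realType) a (v0 : 'cV[int]_3) :
  signature_2_1 R a -> 0 < qform a v0 -> Q_isotropic (stabilizer a v0) ->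
  exists (E F : 'cV[int]_3) (n : int),
    [/\ 0 < n, bform a E v0 = 0 /\ bform a F v0 = 0, qform a E = 0,
        qform a F = 0 & bform a E F = - qform a v0 * n ^+ 2].
Proof.
move=> sgn m0 /stabilizer_isotropic_vector [e [e0 Qe Bev]].
have [t Bt] := bform_nondegenerate sgn e0.
set m := qform a v0 in m0 *.
pose t' := (2%:R * m) *: t - bform a t v0 *: v0.
have Bvv : bform a v0 v0 = 2%:R * m by rewrite bformxx.
have Btv : bform a t' v0 = 0.
  by rewrite /t' -scaleNr bformDl !bformZl Bvv; ring.
have Bet : bform a e t' != 0.
  rewrite /t' -scaleNr bformDr !bformZr Bev mulr0 addr0 !mulf_neq0 //.
  by rewrite gt_eqF.
set b := bform a e t' in Bet.
pose f := b *: t' - qform a t' *: e.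
exists (- m *: e), f, `|b|; split.
- by rewrite normr_gt0.
- split; first by rewrite bformZl Bev mulr0.
  by rewrite /f -scaleNr bformDl !bformZl Btv Bev !mulr0 addr0.
- by rewrite qformZ Qe mulr0.
- rewrite /f -scaleNr qformD !qformZ Qe bformZl bformZr bformC -/b; ring.
- rewrite bformZl /f -scaleNr bformDr !bformZr bformxx Qe -/b.
  by rewrite real_normK ?num_real //; ring.
Qed.

Definition cols3 (A : nzRingType) (E F G : 'cV[A]_3) : 'M[A]_3 :=
  \matrix_(i, j) if j == 0 then E i 0 else if j == 1 then F i 0 else G i 0.

Lemma cols3M (A : comNzRingType) (E F G x : 'cV[A]_3) :
  cols3 E F G *m x = x 0 0 *: E + x 1 0 *: F + x 2%:R 0 *: G.
Proof.
apply/matrixP=> i j; rewrite (ord1 j) !mxE !big_ord_recl big_ord0 !mxE /=.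
have -> : lift ord0 ord0 = 1 :> 'I_3 by apply/val_inj.
have -> : lift ord0 (lift ord0 ord0) = 2%:R :> 'I_3 by apply/val_inj.
have -> : ord0 = 0 :> 'I_3 by apply/val_inj.
by rewrite /=; ring.
Qed.

Lemma qform_cols3 (A : comNzRingType) a (E F v y : 'cV[A]_3) :
  bform a E v = 0 -> bform a F v = 0 -> qform a E = 0 -> qform a F = 0 ->
  qform a (cols3 E F v *m y) =
    y 0 0 * y 1 0 * bform a E F + y 2%:R 0 ^+ 2 * qform a v.
Proof.
move=> BEv BFv QE QF; rewrite cols3M !qformD !qformZ QE QF.
rewrite !bformDl !bformZl !bformZr BEv BFv; ring.
Qed.

(** A linear relation between E, F and v is trivial, as pairing it with F, E
    and v isolates its coefficients. *)
Lemma cols3_det_neq0 a (E F v : 'cV[int]_3) :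
  bform a E v = 0 -> bform a F v = 0 -> qform a E = 0 -> qform a F = 0 ->
  bform a E F != 0 -> qform a v != 0 -> \det (cols3 E F v) != 0.
Proof.
move=> BEv BFv QE QF BEF Qv; rewrite -det_tr; apply/negP => /det0P [u u0].
move=> /(congr1 trmx); rewrite trmx_mul trmxK trmx0 cols3M => h.
have pair (w : 'cV[int]_3) : bform a 0 w = 0 by rewrite -(scale0r 0) bformZl mul0r.
have := pair E; have := pair F; have := pair v.
rewrite -h !bformDl !bformZl !bformxx QE QF BEv BFv !(bformC a v) BEv BFv.
rewrite !(mulr0, addr0, add0r) (bformC a F) => /eqP.
rewrite !mulf_eq0 (negPf Qv) /= orbF => /eqP u2 /eqP.
rewrite mulf_eq0 (negPf BEF) orbF => /eqP u00 /eqP.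
rewrite mulf_eq0 (negPf BEF) orbF => /eqP u1.
move/negP: u0; apply; rewrite -trmx_eq0; apply/eqP/cV3P; rewrite [RHS]mxE.
  - exact: u00.
  - exact: u1.
  - exact: u2.
Qed.

(** The adjugate matrix expresses a multiple of every integral vector as an
    integral combination of E, F and v0.  The factor 2 in front of E and F
    absorbs the half-integral middle coordinate of a symmetric product. *)
Lemma hyperbolic_parametrization (R : realType) a (v0 : 'cV[int]_3) :
  signature_2_1 R a -> 0 < qform a v0 -> Q_isotropic (stabilizer a v0) ->
  exists (E F G : 'cV[int]_3) (K M : int),
    [/\ 0 < K /\ 0 < M,
        forall x X Y W, K *: x = X *: E + Y *: F + W *: G ->
          W ^+ 2 - 4%:R * X * Y = (2%:R * M) ^+ 2 -> qform a x = qform a v0,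
        forall x, qform a x = qform a v0 -> exists X Y Z,
          Z ^+ 2 - X * Y = M ^+ 2 /\ K *: x = X *: E + Y *: F + (2%:R * Z) *: G,
        K *: v0 = (2%:R * M) *: G &
        \det (cols3 E F G) != 0].
Proof.
move=> sgn m0 iso; have [E [F [n [n0 [BEv BFv] QE QF BEF]]]] := hyperbolic_frame sgn m0 iso.
set m := qform a v0 in m0 BEF *.
have d0 : \det (cols3 E F v0) != 0.
  apply: (cols3_det_neq0 BEv BFv QE QF); last by rewrite gt_eqF.
  by rewrite BEF mulf_neq0 ?oppr_eq0 ?expf_neq0 // gt_eqF.
pose d := \det (cols3 E F v0); pose K := 2%:R * n * `|d|.
have K0 : 0 < K by rewrite !mulr_gt0 ?normr_gt0.
have QL X Y W : qform a (X *: (2%:R *: E) + Y *: (2%:R *: F) + W *: (n *: v0)) =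
     m * n ^+ 2 * (W ^+ 2 - 4%:R * X * Y).
  rewrite !qformD !qformZ QE QF !bformDl !bformZl !bformZr BEv BFv BEF -/m.
  ring.
have dd : `|d| ^+ 2 = d ^+ 2 by rewrite real_normK ?num_real.
exists (2%:R *: E), (2%:R *: F), (n *: v0), K, `|d|; split.
- by rewrite normr_gt0.
- move=> x X Y W /(congr1 (@qform a int)); rewrite QL qformZ => h hW.
  have KK : K ^+ 2 != 0 by rewrite expf_neq0 // gt_eqF.
  by apply: (mulfI KK); rewrite h hW /K; ring.
- move=> x Qx; pose y := Num.sg d *: (\adj (cols3 E F v0) *m x).
  have hy : cols3 E F v0 *m y = `|d| *: x.
    by rewrite -scalemxAr mulmxA mul_mx_adj mul_scalar_mx scalerA -normrEsg.
  exists (n * y 0 0), (n * y 1 0), (y 2%:R 0); split.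
    have mn : m != 0 by rewrite gt_eqF.
    apply: (mulfI mn); have := qform_cols3 y BEv BFv QE QF.
    by rewrite hy qformZ Qx -/m BEF [m * `|d| ^+ 2]mulrC => ->; ring.
  rewrite /K -scalerA -hy cols3M !scalerDr !scalerA.
  by congr (_ *: _ + _ *: _ + _ *: _); ring.
- by rewrite scalerA; congr (_ *: _); rewrite /K; ring.
- apply: (@cols3_det_neq0 a); rewrite ?bformZl ?bformZr ?qformZ ?BEv ?BFv ?QE ?QF ?BEF;
   rewrite ?mulr0 // ?mulf_neq0 ?expf_neq0 ?oppr_eq0 ?gt_eqF //.
Qed.

(** * Rank one integral matrices and primitive vectors *)

(** [(sector1 s n i, sector2 s n i)], for 0 < n and i < 2 n, runs over one
    vector of each pair {p, -p} of nonzero integral vectors, and n is its sup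
    norm: the half-open sector -p1 < p2 <= p1 is {(n, n - i)}, and the other
    one is its image under the rotation by a right angle.  The shear from (n, i)
    to the vector preserves the gcd. *)
Definition sector1 (s : bool) (n i : nat) : int := if s then n%:Z else i%:Z - n%:Z.
Definition sector2 (s : bool) (n i : nat) : int := if s then n%:Z - i%:Z else n%:Z.

Lemma coprime_intP (n i : nat) :
  reflect (exists b c : int, b * n%:Z + c * i%:Z = 1) (coprime n i).
Proof.
rewrite -[coprime n i]/(coprimez n%:Z i%:Z).
apply: (iffP (coprimezP _ _)) => [[[b c] /= h]|[b [c h]]]; first by exists b, c.
by exists (b, c).
Qed.

Lemma sector_bezout s n i : coprime n i ->
  exists b c : int, b * sector1 s n i + c * sector2 s n i = 1.
Proof.
case/coprime_intP=> b [c h]; case: s; rewrite /sector1 /sector2.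
  by exists (b + c), (- c); rewrite -h; ring.
by exists c, (b + c); rewrite -h; ring.
Qed.

Lemma sector_normal_form (p1 p2 b c : int) : b * p1 + c * p2 = 1 ->
  exists (e : int) (s : bool) (n i : nat),
    [/\ e ^+ 2 = 1, (0 < n)%N && (i < 2 * n)%N, coprime n i,
      p1 = e * sector1 s n i & p2 = e * sector2 s n i].
Proof.
move=> h.
have key (e : int) (s : bool) (n i : nat) : e ^+ 2 = 1 ->
    (0 < n)%N && (i < 2 * n)%N ->
    p1 = e * sector1 s n i -> p2 = e * sector2 s n i ->
    exists (e : int) (s : bool) (n i : nat),
    [/\ e ^+ 2 = 1, (0 < n)%N && (i < 2 * n)%N, coprime n i,
      p1 = e * sector1 s n i & p2 = e * sector2 s n i].
  move=> e2 ni h1 h2; exists e, s, n, i; split=> //; apply/coprime_intP.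
  move: h; rewrite h1 h2 /sector1 /sector2; case: s {h1 h2} => h.
    by exists (e * (b + c)), (- e * c); rewrite -h; ring.
  by exists (e * (c - b)), (e * b); rewrite -h; ring.
have [A|nA] := boolP ((0 < p1) && (- p1 < p2 <= p1)).
  by apply: (key 1 true `|p1|%N `|p1 - p2|%N); rewrite /sector1 /sector2 ?expr1n //; lia.
have [A|nA'] := boolP ((p1 < 0) && (- (- p1) < - p2 <= - p1)).
  by apply: (key (-1) true `|p1|%N `|p1 - p2|%N); rewrite /sector1 /sector2 ?sqrrN ?expr1n //; lia.
have [B|nB] := boolP ((0 < p2) && (- p2 <= p1 < p2)).
  by apply: (key 1 false `|p2|%N (absz (p1 + p2))); rewrite /sector1 /sector2 ?expr1n //; lia.
apply: (key (-1) false `|p2|%N (absz (p1 + p2))); rewrite /sector1 /sector2 ?sqrrN ?expr1n //.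
all: have : (p1 != 0) || (p2 != 0) by apply: contraPT h => /norP[/negPn/eqP-> /negPn/eqP->]; lia.
all: lia.
Qed.

Lemma sector_inj s n i s' n' i' (e : int) : e ^+ 2 = 1 ->
  (0 < n)%N && (i < 2 * n)%N -> (0 < n')%N && (i' < 2 * n')%N ->
  sector1 s' n' i' = e * sector1 s n i -> sector2 s' n' i' = e * sector2 s n i ->
  [/\ e = 1, s' = s, n' = n & i' = i].
Proof.
move=> /eqP; rewrite sqrf_eq1 => /orP[] /eqP -> h h';
  rewrite /sector1 /sector2; case: s; case: s' => h1 h2; split=> //; lia.
Qed.

Lemma bezout_normalize (x y : int) : (x, y) != (0, 0) ->
  exists g p1 p2 b c : int,
    [/\ g != 0, x = g * p1, y = g * p2 & b * p1 + c * p2 = 1].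
Proof.
move=> xy; have [b [c h]] := Bezoutz x y.
have g0 : gcdz x y != 0.
  by apply: contra xy; rewrite gcdz_eq0 xpair_eqE.
have /dvdzP[p1 hp1] := dvdz_gcdl x y.
have /dvdzP[p2 hp2] := dvdz_gcdr x y.
exists (gcdz x y), p1, p2, b, c; split; rewrite // 1?mulrC //.
have hg : b * (p1 * gcdz x y) + c * (p2 * gcdz x y) = gcdz x y.
  by rewrite -hp1 -hp2.
by apply: (mulfI g0); rewrite mulr1 -[RHS]hg; ring.
Qed.

(** The matrix with rows (X, Z + M) and (Z - M, Y) is singular and nonzero: p
    is the primitive vector along one of its nonzero columns. *)
Lemma rank_one_factorization (X Y Z M : int) : M != 0 -> Z ^+ 2 - X * Y = M ^+ 2 ->
  exists p1 p2 u1 u2 : int, [/\ exists b c, b * p1 + c * p2 = 1,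
    p1 * u1 = X, p2 * u2 = Y, p1 * u2 = Z + M & p2 * u1 = Z - M].
Proof.
move=> M0 h.
have [/eqP|XZ] := eqVneq (X, Z - M) (0, 0).
  rewrite xpair_eqE => /andP[/eqP X0 ZM].
  have [|g [p1 [p2 [b [c [g0 h1 h2 hbc]]]]]] := @bezout_normalize (Z + M) Y.
    by rewrite xpair_eqE; lia.
  exists p1, p2, 0, g; split; rewrite ?mulr0 //; [by exists b, c|..]; lia.
have [g [p1 [p2 [b [c [g0 h1 h2 hbc]]]]]] := bezout_normalize XZ.
have XY : X * Y = (Z - M) * (Z + M).
  by rewrite -[X * Y](subKr (Z ^+ 2)) h; ring.
have hp : p1 * Y = p2 * (Z + M).
  by apply: (mulfI g0); move: XY; rewrite h1 h2 !mulrA.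
exists p1, p2, g, (b * (Z + M) + c * Y); split.
- by exists b, c.
- by rewrite h1 mulrC.
- rewrite mulrDr mulrCA -hp -[RHS]mul1r -hbc; ring.
- rewrite mulrDr (mulrCA p1 c) hp -[RHS]mul1r -hbc; ring.
- by rewrite h2 mulrC.
Qed.

Lemma rank_one_unique (p1 p2 u1 u2 q1 q2 w1 w2 b c b' c' : int) :
  b * p1 + c * p2 = 1 -> b' * q1 + c' * q2 = 1 -> p1 * u2 - p2 * u1 != 0 ->
  p1 * u1 = q1 * w1 -> p2 * u2 = q2 * w2 -> p1 * u2 = q1 * w2 ->
  p2 * u1 = q2 * w1 ->
  exists e : int, [/\ e ^+ 2 = 1, q1 = e * p1, q2 = e * p2, u1 = e * w1 & u2 = e * w2].
Proof.
move=> hp hq hd h11 h22 h12 h21.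
(* e and e' are inverse to each other: u = e w and w = e' u. *)
pose e := b * q1 + c * q2; pose e' := b' * p1 + c' * p2.
have hu1 : u1 = e * w1 by rewrite -[LHS]mul1r -hp mulrDl -!mulrA h11 h21 /e; ring.
have hu2 : u2 = e * w2 by rewrite -[LHS]mul1r -hp mulrDl -!mulrA h12 h22 /e; ring.
have hw1 : w1 = e' * u1 by rewrite -[LHS]mul1r -hq mulrDl -!mulrA -h11 -h21 /e'; ring.
have hw2 : w2 = e' * u2 by rewrite -[LHS]mul1r -hq mulrDl -!mulrA -h12 -h22 /e'; ring.
have e2 : e ^+ 2 = 1.
  have ee' : e * e' = 1.
    have [u0|u0] := eqVneq u1 0.
      have u20 : u2 != 0 by apply: contra hd => /eqP->; rewrite u0 !mulr0 subrr.
      by apply: (mulIf u20); rewrite mul1r -mulrA -hw2 -hu2.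
    by apply: (mulIf u0); rewrite mul1r -mulrA -hw1 -hu1.
  move/(congr1 absz): ee'; rewrite abszM => /eqP; rewrite muln_eq1 => /andP[he _].
  by have [->|->] : e = 1 \/ e = -1 by lia.
exists e; split=> //.
- have [w0|w0] := eqVneq w1 0.
    have w20 : w2 != 0.
      by apply: contra hd => /eqP w20; rewrite hu1 hu2 w0 w20 !mulr0 subrr.
    by apply: (mulIf w20); rewrite -h12 hu2; ring.
  by apply: (mulIf w0); rewrite -h11 hu1; ring.
- have [w0|w0] := eqVneq w1 0.
    have w20 : w2 != 0.
      by apply: contra hd => /eqP w20; rewrite hu1 hu2 w0 w20 !mulr0 subrr.
    by apply: (mulIf w20); rewrite -h22 hu2; ring.
  by apply: (mulIf w0); rewrite -h21 hu1; ring.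
Qed.

(** * Residue classes and the harmonic sum *)

(** A Cauchy-type criterion: it applies to the sequences obtained by adding to
    and subtracting from a sequence an a priori bound of its distance to its
    limit, and gives the limit together with the speed of convergence. *)
Lemma exists_between (R : realType) (lo hi : nat -> R) :
  (forall n m, lo n <= hi m) -> exists x, forall n, lo n <= x <= hi n.
Proof.
move=> h; exists (sup (range lo)) => n; apply/andP; split.
  apply: sup_ubound; last by exists n.
  by exists (hi 0%N) => _ [m _ <-].
apply: sup_le_ub; first by exists (lo 0%N), 0%N.
by move=> _ [m _ <-].
Qed.

Lemma sum_residues (R : realType) (y : nat -> R) (N K r : nat) : (0 < K)%N ->
  \sum_(k < K) \sum_(i < N | (i == r + k %[mod K])%N) y i = \sum_(i < N) y i.
Proof.
move=> K0; under eq_bigr do rewrite big_mkcond /=.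
rewrite exchange_big /=; apply: eq_bigr => i _; rewrite -big_mkcond /=.
pose k0 := Ordinal (ltn_pmod (i + (K.-1) * r) K0).
rewrite (big_pred1 k0) // => k /=.
apply/eqP/eqP => [h|->].
  apply/val_inj; rewrite /= -(modnDml (nat_of_ord i)) h modnDml addnAC -mulSn.
  by rewrite prednK // mulnC -modnDml modnMl add0n modn_small.
rewrite /= modnDmr addnCA -mulSn prednK // mulnC.
by rewrite -modnDmr modnMl addn0.
Qed.

(** Shifting the residue by one changes the sum by at most the total variation
    of the sequence and two boundary terms, so the K residues have nearly equal
    shares. *)
Lemma residue_equidistribution (R : realType) (y : nat -> R) (N K r : nat) (B V : R) :
  (0 < K)%N -> (forall i, (i <= N)%N -> `|y i| <= B) ->
  \sum_(i < N) `|y i - y i.+1| <= V ->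
  `|K%:R * (\sum_(i < N | (i == r %[mod K])%N) y i) - \sum_(i < N) y i|
    <= K%:R ^+ 2 * (V + 2%:R * B).
Proof.
move=> K0 yB yV.
pose c s := \sum_(i < N | (i == s %[mod K])%N) y i.
have B0 : 0 <= B by apply: le_trans (yB 0%N (leq0n _)); exact: normr_ge0.
have step s : `|c s - c s.+1| <= V + 2%:R * B.
  pose z i := if (i == s.+1 %[mod K])%N then y i else 0.
  have zB i : (i <= N)%N -> `|z i| <= B.
    by move=> iN; rewrite /z; case: ifP => _; rewrite ?normr0 //; exact: yB.
  have -> : c s.+1 = \sum_(i < N) z i.+1 + (z 0%N - z N).
    rewrite /c big_mkcond /= -/(z _).
    have h : \sum_(i < N.+1) z i = z 0%N + \sum_(i < N) z i.+1 by rewrite big_ord_recl.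
    by rewrite big_ord_recr /= in h; rewrite addrC addrAC -h addrK.
  have -> : \sum_(i < N) z i.+1 = \sum_(i < N | (i == s %[mod K])%N) y i.+1.
    rewrite [RHS]big_mkcond; apply: eq_bigr => i _; rewrite /z.
    by rewrite -(addn1 i) -(addn1 s) eqn_modDr.
  rewrite opprD addrA -sumrB.
  apply: le_trans (ler_normB _ _) _.
  apply: lerD.
    apply: le_trans (ler_norm_sum _ _ _) _.
    apply: le_trans yV; rewrite big_mkcond; apply: ler_sum => i _.
    by case: ifP.
  apply: le_trans (ler_normB _ _) _; rewrite mulr_natl mulr2n.
  by apply: lerD; apply: zB.
have steps s k : `|c s - c (s + k)%N| <= k%:R * (V + 2%:R * B).
  elim: k => [|k IH]; first by rewrite addn0 subrr normr0 mul0r.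
  rewrite addnS -[c s](subrK (c (s + k)%N)) -addrA.
  apply: le_trans (ler_normD _ _) _.
  by rewrite -natr1 mulrDl mul1r; apply: lerD.
rewrite -(sum_residues _ _ r K0) -/(c _).
rewrite (_ : K%:R * c r = \sum_(k < K) c r); last first.
  by rewrite sumr_const card_ord mulr_natl.
rewrite -sumrB; apply: le_trans (ler_norm_sum _ _ _) _.
have V0 : 0 <= V + 2%:R * B by apply: le_trans (step 0%N); exact: normr_ge0.
apply: (@le_trans _ _ (\sum_(k < K) K%:R * (V + 2%:R * B))).
  apply: ler_sum => k _; apply: le_trans (steps _ _) _.
  by rewrite ler_wpM2r // ler_nat ltnW.
by rewrite sumr_const card_ord expr2 -mulrA [leRHS]mulr_natl.
Qed.

Lemma ln_natS_bounds (R : realType) (n : nat) : (0 < n)%N ->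
  (n.+1%:R : R)^-1 <= ln n.+1%:R - ln n%:R <= (n%:R : R)^-1.
Proof.
move=> n0; have n0R : 0 < n%:R :> R by rewrite ltr0n.
have n1R : 0 < n.+1%:R :> R by rewrite ltr0n.
apply/andP; split.
  rewrite -opprB -ln_div ?posrE // lerNr.
  have -> : n%:R / n.+1%:R = 1 + - n.+1%:R^-1 :> R.
    by rewrite -natr1; field; rewrite natr1 gt_eqF.
  apply: le_ln1Dx; rewrite ltrN2 invf_lt1 ?ltr1n //.
rewrite -ln_div ?posrE //.
have -> : n.+1%:R / n%:R = 1 + n%:R^-1 :> R by rewrite -natr1; field; rewrite gt_eqF.
by apply: le_ln1Dx; rewrite (lt_trans (ltrN10 _)) ?invr_gt0.
Qed.

Lemma harmonic_ln (R : realType) (X : nat) : (0 < X)%N ->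
  `|\sum_(n < X.+1) (n%:R : R)^-1 - ln X%:R| <= 1.
Proof.
move=> X0; suff: ln X.+1%:R <= \sum_(n < X.+1) (n%:R : R)^-1 <= 1 + ln X%:R.
  have : ln X%:R <= ln X.+1%:R :> R by rewrite ler_ln ?posrE ?ltr0n // ler_nat.
  by move=> h0 /andP[h1 h2]; rewrite ler_norml; apply/andP; split; lra.
case: X X0 => // X _; elim: X => [|X IH].
  rewrite !big_ord_recr big_ord0 /= ln1 invr0 invr1 !add0r addr0 lexx andbT.
  by have /andP[_] := @ln_natS_bounds R 1 isT; rewrite ln1 invr1 subr0.
rewrite big_ord_recr /=; have /andP[_] := @ln_natS_bounds R X.+2 isT.
have /andP[+ _] := @ln_natS_bounds R X.+1 isT.
move: IH => /andP[]; move: (ln X.+3%:R) (ln X.+2%:R) (ln X.+1%:R) (_^-1) (bigop _ _ _).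
by move=> a b c d e h1 h2 h3 h4; apply/andP; split; lra.
Qed.

(** This makes the sums of 1 / d^2 telescope. *)
Lemma inv_telescope (R : realType) (n : nat) : (0 < n)%N ->
  (n.+1%:R : R) ^- 2 <= n%:R^-1 - n.+1%:R^-1.
Proof.
move=> n0; have n0R : 0 < n%:R :> R by rewrite ltr0n.
have n1R : 0 < n.+1%:R :> R by rewrite ltr0n.
have -> : n%:R^-1 - n.+1%:R^-1 = (n%:R * n.+1%:R)^-1 :> R.
  by rewrite -natr1; field; rewrite natr1 !gt_eqF.
by rewrite lef_pV2 ?posrE ?mulr_gt0 ?exprn_gt0 // expr2 ler_wpM2r ?ler0n // ler_nat.
Qed.

Lemma sum_inv_sq_tail (R : realType) (P : pred nat) (X Y : nat) : (0 < X <= Y)%N ->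
  \sum_(X.+1 <= d < Y.+1 | P d) (d%:R : R) ^- 2 <= X%:R^-1 - Y%:R^-1.
Proof.
move=> /andP[X0 /subnK <-]; elim: (Y - X)%N => [|k IH].
  by rewrite add0n big_geq // subrr.
rewrite addSn big_mkcond big_nat_recr /=; last by rewrite ltnS leq_addl.
rewrite -big_mkcond /=.
have := @inv_telescope R (k + X) (ltn_addl k X0).
have : 0 <= ((k + X).+1%:R : R) ^- 2 by rewrite invr_ge0 exprn_ge0 ?ler0n.
move: IH; case: ifP => _.
all: move: (bigop _ _ _) (_ ^-1) (_^-1) (_ ^-1) (_^-1) => a b c d e; lra.
Qed.

Lemma sum_inv_sq_le2 (R : realType) (X : nat) :
  \sum_(n < X.+1) (n%:R : R) ^- 2 <= 2%:R.
Proof.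
rewrite -(big_mkord xpredT (fun n => (n%:R : R) ^- 2)) big_ltn // expr0n invr0 add0r.
case: X => [|X]; first by rewrite big_geq.
rewrite big_ltn // expr1n invr1.
have := @sum_inv_sq_tail R xpredT 1 X.+1 isT; rewrite invr1.
have : 0 <= (X.+1%:R : R)^-1 by rewrite invr_ge0.
by move: (bigop _ _ _) (_^-1) => u v; lra.
Qed.

Lemma residue_harmonic (R : realType) (K : nat) : (0 < K)%N -> exists C : R,
  forall r X, (0 < X)%N ->
  `|\sum_(n < X.+1 | (n == r %[mod K])%N) (n%:R : R)^-1 - K%:R^-1 * ln X%:R| <= C.
Proof.
move=> K0; exists (K%:R^-1 * (K%:R ^+ 2 * (2%:R + 2%:R * 1) + 1)) => r X X0.
have KR : 0 < K%:R :> R by rewrite ltr0n.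
set s := \sum_(n < _ | _) _.
rewrite (_ : s - _ = K%:R^-1 * (K%:R * s - ln X%:R)); last by field; rewrite gt_eqF.
rewrite normrM gtr0_norm ?invr_gt0 // ler_wpM2l ?invr_ge0 ?ler0n //.
rewrite (_ : K%:R * s - ln X%:R = (K%:R * s - \sum_(n < X.+1) (n%:R : R)^-1)
   + (\sum_(n < X.+1) (n%:R : R)^-1 - ln X%:R)); last by ring.
apply: le_trans (ler_normD _ _) _; apply: lerD; last exact: harmonic_ln.
apply: (@residue_equidistribution R (fun n => (n%:R : R)^-1)) => //.
  case=> [|i] _; first by rewrite invr0 normr0.
  by rewrite ger0_norm ?invr_ge0 ?ler0n // invf_le1 ?ltr0n // ler1n.
rewrite big_ord_recl invr0 invr1 sub0r normrN normr1.
suff: \sum_(i < X) `|(bump 0 i)%:R^-1 - (bump 0 i).+1%:R^-1| <= 1 - (X.+1%:R : R)^-1.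
  have : 0 <= (X.+1%:R : R)^-1 by rewrite invr_ge0.
  by move: (_^-1) (bigop _ _ _) => u v; lra.
elim: {s X0} X => [|X IH]; first by rewrite big_ord0 invr1 subrr.
rewrite big_ord_recr /= /bump /= add1n ger0_norm; last first.
  by rewrite subr_ge0 lef_pV2 ?posrE ?ltr0n // ler_nat.
rewrite /bump /= in IH; move: IH.
have H (a u v : R) : a <= 1 - u -> a + (u - v) <= 1 - v by lra.
exact: H.
Qed.

(** * Riemann sums *)

Lemma sum_blocks (R : nmodType) (F : nat -> R) (a m : nat) :
  \sum_(i < a * m) F i = \sum_(i < a) \sum_(k < m) F (i * m + k)%N.
Proof.
elim: a => [|a IH]; first by rewrite mul0n !big_ord0.
by rewrite big_ord_recr -IH mulSn addnC big_split_ord.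
Qed.

(** The functions g for which g (i / n) / n^2, as a function of the pair (n, i),
    is a homogeneous weight of degree -2 on a sector of the plane. *)
Record slope_density (R : realType) (g : R -> R) (L B : R) : Prop := SlopeDensity {
  slope_lipschitz : forall s t, 0 <= s <= 2%:R -> 0 <= t <= 2%:R ->
    `|g s - g t| <= L * `|s - t|;
  slope_bounded : forall s, 0 <= s <= 2%:R -> g s <= B;
  slope_positive : exists2 c, 0 < c & forall s, 0 <= s <= 2%:R -> c <= g s }.

Lemma ratio_le2 (R : realType) (n i : nat) : (0 < n)%N -> (i <= 2 * n)%N ->
  0 <= (i%:R / n%:R : R) <= 2%:R.
Proof.
move=> n0 i2n; rewrite divr_ge0 //= ler_pdivrMr ?ltr0n // -natrM ler_nat //.
Qed.

Lemma slope_lipschitz_ge0 (R : realType) (g : R -> R) (L B : R) :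
  slope_density g L B -> 0 <= L.
Proof.
move=> gd; have := @slope_lipschitz _ _ _ _ gd 1 0; rewrite subr0 normr1 mulr1.
by rewrite !lexx !ler01 !ler0n ler1n => /(_ isT isT); apply: le_trans; exact: normr_ge0.
Qed.

Lemma slope_bounded_norm (R : realType) (g : R -> R) (L B : R) :
  slope_density g L B -> forall s, 0 <= s <= 2%:R -> `|g s| <= B.
Proof.
move=> gd s hs; have [c c0 hc] := slope_positive gd.
rewrite ger0_norm ?(slope_bounded gd) //; exact: le_trans (ltW c0) (hc _ hs).
Qed.

(** Each of the 2 n cells of mesh 1 / n is cut into m cells, on which g differs
    from its value at the left end by at most L / n. *)
Lemma riemann_refinement (R : realType) (g : R -> R) (L B : R) (n m : nat) :
  slope_density g L B -> (0 < n)%N -> (0 < m)%N ->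
  `|\sum_(i < 2 * (n * m)) g (i%:R / (n * m)%:R)
     - m%:R * \sum_(i < 2 * n) g (i%:R / n%:R)| <= 2%:R * m%:R * L.
Proof.
move=> gd n0 m0; have L0 := slope_lipschitz_ge0 gd.
have n0R : 0 < n%:R :> R by rewrite ltr0n.
have m0R : 0 < m%:R :> R by rewrite ltr0n.
rewrite mulnA (sum_blocks (fun i => g (i%:R / (n * m)%:R))).
rewrite mulr_sumr -sumrB; apply: le_trans (ler_norm_sum _ _ _) _.
apply: (@le_trans _ _ (\sum_(i < 2 * n) m%:R * (L / n%:R))); last first.
  rewrite sumr_const card_ord -[leLHS]mulr_natl natrM le_eqVlt; apply/orP; left.
  by apply/eqP; field; rewrite gt_eqF.
apply: ler_sum => i _.
rewrite (_ : m%:R * g _ = \sum_(k < m) g (i%:R / n%:R)); last first.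
  by rewrite sumr_const card_ord mulr_natl.
rewrite -sumrB; apply: le_trans (ler_norm_sum _ _ _) _.
rewrite (_ : m%:R * (L / n%:R) = \sum_(k < m) (L / n%:R)); last first.
  by rewrite sumr_const card_ord mulr_natl.
apply: ler_sum => k _.
have hi : (i <= 2 * n)%N by rewrite ltnW.
have hk : (i * m + k <= 2 * (n * m))%N.
  rewrite mulnA (@leq_trans (i.+1 * m)%N) // ?leq_mul2r ?ltn_ord ?orbT //.
  by rewrite [leqRHS]mulSn [leqRHS]addnC leq_add2l ltnW.
apply: le_trans (slope_lipschitz gd (ratio_le2 R _ hk) (ratio_le2 R n0 hi)) _.
  by rewrite muln_gt0 n0.
rewrite ler_wpM2l //.
rewrite (_ : _ - _ = k%:R / m%:R / n%:R); last first.
  by rewrite natrD !natrM; field; rewrite !gt_eqF.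
rewrite ger0_norm ?divr_ge0 ?ler0n // ler_piMl ?invr_ge0 ?ler0n //.
by rewrite ler_pdivrMr // mul1r ler_nat ltnW.
Qed.

(** The meshes 1 / n and 1 / m are compared through their common refinement
    1 / (n m), which shows that all the Riemann sums agree up to the stated
    error. *)
Lemma riemann_sum (R : realType) (g : R -> R) (L B : R) : slope_density g L B ->
  exists2 I, 0 < I & forall n, (0 < n)%N ->
    `|\sum_(i < 2 * n) g (i%:R / n%:R) - n%:R * I| <= 2%:R * L.
Proof.
move=> gd; pose S n : R := \sum_(i < 2 * n) g (i%:R / n%:R).
pose a n : R := S n / n%:R.
have L0 := slope_lipschitz_ge0 gd.
have close n m : (0 < n)%N -> (0 < m)%N -> `|a (n * m)%N - a n| <= 2%:R * L / n%:R.
  move=> n0 m0; have := riemann_refinement gd n0 m0; rewrite -/(S _) -/(S _) => h.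
  have n0R : 0 < n%:R :> R by rewrite ltr0n.
  have m0R : 0 < m%:R :> R by rewrite ltr0n.
  rewrite /a (_ : _ - _ = (S (n * m)%N - m%:R * S n) / (n%:R * m%:R)); last first.
    by rewrite natrM; field; rewrite !gt_eqF.
  rewrite normrM [X in _ * X]gtr0_norm ?invr_gt0 ?mulr_gt0 //.
  rewrite ler_pdivrMr ?mulr_gt0 //; apply: le_trans h _.
  by rewrite le_eqVlt; apply/orP; left; apply/eqP; field; rewrite gt_eqF.
have [I HI] : exists I, forall n, a n.+1 - 2%:R * L / n.+1%:R <= I <= a n.+1 + 2%:R * L / n.+1%:R.
  apply: (@exists_between R (fun n => a n.+1 - 2%:R * L / n.+1%:R)
    (fun n => a n.+1 + 2%:R * L / n.+1%:R)) => n m.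
  have := close n.+1 m.+1 isT isT; have := close m.+1 n.+1 isT isT.
  rewrite mulnC !ler_norml => /andP[_ h1] /andP[h2 _].
  by move: h1 h2; move: (a _) (a _) (a _) (_ / _) (_ / _) => x y z t u; lra.
have HI' n : (0 < n)%N -> `|a n - I| <= 2%:R * L / n%:R.
  by case: n => // n _; have /andP[h1 h2] := HI n; rewrite ler_norml; apply/andP; split;
    move: h1 h2; move: (a _) (_ / _) => x y; lra.
exists I; last first.
  move=> n n0; have n0R : 0 < n%:R :> R by rewrite ltr0n.
  have := HI' n n0; rewrite -(ler_pM2r n0R) divfK ?gt_eqF //; apply: le_trans.
  by rewrite -[X in _ <= _ * X](gtr0_norm n0R) -normrM /a mulrBl divfK ?gt_eqF // (mulrC I).
have [c c0 hc] := slope_positive gd.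
pose n := (Num.trunc (2%:R * L / c)).+1.
have n0R : 0 < n%:R :> R by rewrite ltr0n.
have hn : 2%:R * L / n%:R < c.
  rewrite ltr_pdivrMr // [c * _]mulrC -ltr_pdivrMr //.
  have h0 : 0 <= 2%:R * L / c by rewrite !mulr_ge0 // invr_ge0 ltW.
  by have /andP[_ h1] := truncn_itv h0; exact: h1.
have ha : 2%:R * c <= a n.
  rewrite ler_pdivlMr // /S (@le_trans _ _ (\sum_(i < 2 * n) c)) //.
    by rewrite sumr_const card_ord -[leRHS]mulr_natl natrM le_eqVlt; apply/orP; left; apply/eqP; ring.
  by apply: ler_sum => i _; apply: hc; apply: ratio_le2 => //; rewrite ltnW.
have /andP[] := HI n.-1; rewrite -/n => h _.
by move: hn ha h; move: (_ / _) (a n) => x y; lra.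
Qed.

(** * Sums over coprime pairs *)

Definition sector_sum (R : realType) (g : R -> R) (P : nat -> nat -> bool) (X : nat) : R :=
  \sum_(n < X.+1) \sum_(i < 2 * n | P n i) g (i%:R / n%:R) / n%:R ^+ 2.

Definition residue_class (K r1 r2 n i : nat) : bool :=
  ((n == r1 %[mod K]) && (i == r2 %[mod K]))%N.

Lemma residue_riemann_sum (R : realType) (g : R -> R) (L B : R) (K r n : nat) :
  slope_density g L B -> (0 < K)%N -> (0 < n)%N ->
  `|K%:R * (\sum_(i < 2 * n | (i == r %[mod K])%N) g (i%:R / n%:R))
     - \sum_(i < 2 * n) g (i%:R / n%:R)| <= K%:R ^+ 2 * (2%:R * L + 2%:R * B).
Proof.
move=> gd K0 n0; have L0 := slope_lipschitz_ge0 gd.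
apply: (@residue_equidistribution R (fun i => g (i%:R / n%:R))) => //.
  by move=> i hi; apply: (slope_bounded_norm gd); exact: ratio_le2.
apply: (@le_trans _ _ (\sum_(i < 2 * n) L * n%:R^-1)).
  apply: ler_sum => i _; have hi := ltn_ord i.
  apply: le_trans (slope_lipschitz gd (ratio_le2 R n0 (ltnW hi)) (ratio_le2 R n0 hi)) _.
  rewrite ler_wpM2l // -mulrBl -natr1 opprD addNKr mulN1r normrN.
  by rewrite ger0_norm // invr_ge0.
rewrite sumr_const card_ord -[leLHS]mulr_natl natrM le_eqVlt; apply/orP; left.
by apply/eqP; field; rewrite pnatr_eq0 -lt0n.
Qed.

(** For a fixed n the inner sum is n I / K up to a bounded error, which costs a
    convergent sum of 1 / n^2; what remains is I / K times a harmonic sum over a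
    residue class.  The constant c is the same for all classes. *)
Lemma sector_sum_residue_class (R : realType) (g : R -> R) (L B : R) (K : nat) :
  slope_density g L B -> (0 < K)%N ->
  exists2 c, 0 < c & exists C, forall r1 r2 X, (0 < X)%N ->
    `|sector_sum g (residue_class K r1 r2) X - c * ln X%:R| <= C.
Proof.
move=> gd K0; have KR : 0 < K%:R :> R by rewrite ltr0n.
have [I I0 HI] := riemann_sum gd; have [H HH] := @residue_harmonic R K K0.
exists (I / K%:R * K%:R^-1); first by rewrite !divr_gt0 // invr_gt0.
pose D := (K%:R ^+ 2 * (2%:R * L + 2%:R * B) + 2%:R * L) / K%:R.
exists (D * 2%:R + I / K%:R * H) => r1 r2 X X0.
pose T n := \sum_(i < 2 * n | (i == r2 %[mod K])%N) g (i%:R / n%:R).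
have TD n : (0 < n)%N -> `|T n - n%:R * (I / K%:R)| <= D.
  move=> n0; rewrite /D ler_pdivlMr // -[X in _ * X <= _](gtr0_norm KR) -normrM.
  rewrite (_ : _ * K%:R = (K%:R * T n - \sum_(i < 2 * n) g (i%:R / n%:R))
      + (\sum_(i < 2 * n) g (i%:R / n%:R) - n%:R * I)); last first.
    by field; rewrite gt_eqF.
  apply: le_trans (ler_normD _ _) _; apply: lerD; last exact: HI.
  exact: (residue_riemann_sum r2 gd K0 n0).
have D0 : 0 <= D by apply: le_trans (TD 1%N isT); exact: normr_ge0.
have -> : sector_sum g (residue_class K r1 r2) X =
    \sum_(n < X.+1 | (n == r1 %[mod K])%N) T n / n%:R ^+ 2.
  rewrite /sector_sum [RHS]big_mkcond; apply: eq_bigr => n _.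
  rewrite /residue_class; case: ifP => h; last by rewrite big_pred0.
  by rewrite /T mulr_suml; apply: eq_bigl.
set hs := \sum_(n < X.+1 | (n == r1 %[mod K])%N) (n%:R : R)^-1.
rewrite (_ : _ - _ = \sum_(n < X.+1 | (n == r1 %[mod K])%N)
    (T n / n%:R ^+ 2 - I / K%:R * n%:R^-1) +
    I / K%:R * (hs - K%:R^-1 * ln X%:R)); last first.
  by rewrite sumrB -mulr_sumr -/hs; ring.
apply: le_trans (ler_normD _ _) _; apply: lerD; last first.
  rewrite normrM gtr0_norm ?divr_gt0 // ler_wpM2l ?HH //.
  by rewrite divr_ge0 // ltW.
apply: le_trans (ler_norm_sum _ _ _) _.
apply: (@le_trans _ _ (\sum_(n < X.+1) D * (n%:R : R) ^- 2)); last first.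
  by rewrite -mulr_sumr ler_wpM2l // sum_inv_sq_le2.
rewrite big_mkcond; apply: ler_sum => n _.
case: ifP => _; last by rewrite mulr_ge0 // invr_ge0 exprn_ge0.
have [n0|n0] := posnP (n : nat).
  by rewrite n0 expr0n invr0 !mulr0 subrr normr0.
have nR : 0 < n%:R :> R by rewrite ltr0n.
rewrite (_ : _ - _ = (T n - n%:R * (I / K%:R)) * n%:R ^- 2); last first.
  by field; rewrite !gt_eqF.
rewrite normrM [X in _ * X]gtr0_norm ?invr_gt0 ?exprn_gt0 //.
by rewrite ler_wpM2r ?TD // invr_ge0 exprn_ge0 // ltW.
Qed.

Lemma sum_multiples (R : nmodType) (F : nat -> R) (d N M : nat) :
  (forall m, (m < M)%N = (d * m < N)%N) -> (0 < d)%N ->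
  \sum_(n < N | (d %| n)%N) F n = \sum_(m < M) F (d * m)%N.
Proof.
move=> h d0; rewrite -(big_mkord (fun n => (d %| n)%N)) -(big_mkord xpredT (fun m => F (d * m)%N)).
rewrite -big_filter -[RHS](big_map (fun m => (d * m)%N) xpredT F).
apply: perm_big; apply: uniq_perm.
- by rewrite filter_uniq // iota_uniq.
- rewrite map_inj_uniq ?iota_uniq // => x y /eqP; rewrite eqn_pmul2l //; exact: eqP.
move=> n; rewrite mem_filter mem_index_iota /=; apply/andP/mapP.
  move=> [/dvdnP[m ->] hm]; exists m; last by rewrite mulnC.
  by rewrite mem_index_iota /= h mulnC.
by move=> [m]; rewrite mem_index_iota /= h => hm ->; rewrite dvdn_mulr.
Qed.

Definition coprime_class (K r1 r2 n i : nat) : bool :=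
  residue_class K r1 r2 n i && coprime n i.

(** The pairs of gcd d are the multiples by d of the coprime pairs.  If d is
    coprime to K, division by d maps the class to another class modulo K;
    otherwise the class contains no multiple of d, because its own gcd is
    coprime to K. *)
Lemma sector_sum_gcd_part (R : realType) (g : R -> R) (K r1 r2 d X : nat) :
  (0 < K)%N -> (0 < d)%N -> coprime (gcdn r1 r2) K ->
  exists s1 s2, coprime (gcdn s1 s2) K /\
  sector_sum g (fun n i => residue_class K r1 r2 n i && (gcdn n i == d)) X =
  if coprime d K then sector_sum g (coprime_class K s1 s2) (X %/ d) / d%:R ^+ 2 else 0.
Proof.
move=> K0 d0 rK; have dR : 0 < d%:R :> R by rewrite ltr0n.
case dK: (coprime d K); last first.
  exists 1%N, 0%N; rewrite gcdn0 coprime1n; split=> //.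
  rewrite /sector_sum big1 // => n _; rewrite big_pred0 // => i.
  apply: contraFF dK => /andP[/andP[/eqP h1 /eqP h2] /eqP hd].
  rewrite /coprime -dvdn1; move: rK; rewrite /coprime => /eqP <-.
  rewrite !dvdn_gcd dvdn_gcdr andbT.
  have dn : (d %| n)%N by rewrite -hd dvdn_gcdl.
  have di : (d %| i)%N by rewrite -hd dvdn_gcdr.
  have key m r : m = r %[mod K] -> (d %| m)%N -> (gcdn d K %| r)%N.
    move=> h dm; have : (gcdn d K %| r %% K)%N.
      rewrite -h /dvdn modn_dvdm ?dvdn_gcdr //.
      exact: dvdn_trans (dvdn_gcdl _ _) dm.
    by rewrite /dvdn modn_dvdm ?dvdn_gcdr.
  by rewrite (key _ _ h1 dn) (key _ _ h2 di).
have [e [eK he]] : exists e, coprime e K /\ (e * d = 1 %[mod K])%N.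
  have /(coprimeP _ d0) [[e v] /= h] := dK.
  have hed : (e * d = 1 + v * K)%N by lia.
  exists e; split; last by rewrite hed addnC modnMDl.
  have : coprime (e * d) K by rewrite hed /coprime -gcdn_modl addnC modnMDl gcdn_modl gcd1n.
  by rewrite coprimeMl => /andP[].
exists (e * r1)%N, (e * r2)%N; split.
  by rewrite -muln_gcdr coprimeMl eK.
have mulK m r : (d * m == r %[mod K])%N = (m == e * r %[mod K])%N.
  apply/eqP/eqP => h.
    by rewrite -modnMmr -h modnMmr mulnA -modnMml he modnMml mul1n.
  by rewrite -modnMmr h modnMmr mulnA (mulnC d) -modnMml he modnMml mul1n.
rewrite /sector_sum mulr_suml.
rewrite [LHS](_ : _ = \sum_(n < X.+1 | (d %| n)%N)
    \sum_(i < 2 * n | residue_class K r1 r2 n i && (gcdn n i == d))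
      g (i%:R / n%:R) / n%:R ^+ 2); last first.
  rewrite [RHS]big_mkcond; apply: eq_bigr => n _; case: ifP => // dn.
  rewrite big_pred0 // => i; apply: contraFF dn => /andP[_ /eqP <-].
  exact: dvdn_gcdl.
rewrite (@sum_multiples _ (fun n => \sum_(i < 2 * n |
    residue_class K r1 r2 n i && (gcdn n i == d)) g (i%:R / n%:R) / n%:R ^+ 2)
    d X.+1 (X %/ d).+1) //; last first.
  by move=> m; rewrite !ltnS leq_divRL // mulnC.
apply: eq_bigr => m _.
rewrite [LHS](_ : _ = \sum_(i < 2 * (d * m) | (d %| i)%N)
    (if residue_class K r1 r2 (d * m) i && (gcdn (d * m) i == d) then
      g (i%:R / (d * m)%:R) / (d * m)%:R ^+ 2 else 0)); last first.
  rewrite -big_mkcondr; apply: eq_bigl => i.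
  case h: (_ && _); last by rewrite andbF.
  case/andP: h => _ /eqP h; rewrite andbT.
  by have := dvdn_gcdr (d * m) i; rewrite h => ->.
rewrite (@sum_multiples _ (fun i =>
    (if residue_class K r1 r2 (d * m) i && (gcdn (d * m) i == d) then
      g (i%:R / (d * m)%:R) / (d * m)%:R ^+ 2 else 0)) d _ (2 * m)) //; last first.
  by move=> k; rewrite mulnCA ltn_pmul2l.
rewrite mulr_suml [RHS]big_mkcond; apply: eq_bigr => k _.
rewrite /coprime_class /residue_class !mulK -muln_gcdr /coprime.
rewrite [X in _ && X](_ : _ = (gcdn m k == 1)%N); last first.
  by rewrite -[X in _ == X]muln1 eqn_pmul2l.
case: ifP => // _.
have m0 : (0 < m)%N by have := ltn_ord k; lia.
have mR : 0 < m%:R :> R by rewrite ltr0n.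
rewrite !natrM; have -> : d%:R * k%:R / (d%:R * m%:R) = k%:R / m%:R :> R.
  by field; rewrite !gt_eqF.
by field; rewrite !gt_eqF.
Qed.

Lemma sector_sum_gcd_split (R : realType) (g : R -> R) (P : nat -> nat -> bool) (X : nat) :
  sector_sum g P X =
  \sum_(1 <= d < X.+1) sector_sum g (fun n i => P n i && (gcdn n i == d)) X.
Proof.
rewrite /sector_sum exchange_big /=; apply: eq_bigr => n _.
under [RHS]eq_bigr do rewrite big_mkcondr /=.
rewrite exchange_big /=; apply: eq_bigr => i _.
have n0 : (0 < n)%N by have := ltn_ord i; lia.
have gX : (gcdn n i < X.+1)%N.
  by rewrite (leq_ltn_trans _ (ltn_ord n)) // dvdn_leq // dvdn_gcdl.
rewrite (bigD1_seq (gcdn n i)) ?iota_uniq //=; last first.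
  by rewrite mem_index_iota gcdn_gt0 n0.
by rewrite eqxx big1 ?addr0 // => d; rewrite eq_sym => /negPf ->.
Qed.

Lemma sum_inv_sq_limit (R : realType) (P : pred nat) : exists2 b : R, 0 <= b &
  forall X, (0 < X)%N ->
    \sum_(2 <= d < X.+1 | P d) (d%:R : R) ^- 2 <= b <=
    \sum_(2 <= d < X.+1 | P d) (d%:R : R) ^- 2 + X%:R^-1.
Proof.
pose s X : R := \sum_(2 <= d < X.+1 | P d) (d%:R : R) ^- 2.
have smono X Y : (X <= Y)%N -> s X <= s Y.
  move=> XY; rewrite /s.
  have [X1|X1] := ltnP X 1.
    rewrite big_geq; last by lia.
    by rewrite sumr_ge0 // => d _; rewrite invr_ge0 exprn_ge0.
  rewrite [leRHS](@big_cat_nat _ _ _ X.+1) //= lerDl.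
  by rewrite sumr_ge0 // => d _; rewrite invr_ge0 exprn_ge0.
have stail X Y : (0 < X <= Y)%N -> s Y <= s X + X%:R^-1.
  move=> /andP[X0 XY]; rewrite /s [leLHS](@big_cat_nat _ _ _ X.+1) //= lerD2l.
  apply: le_trans (@sum_inv_sq_tail R P X Y _) _; first by rewrite X0.
  by rewrite gerBl invr_ge0.
have [|b hb] := @exists_between R (fun n => s n.+1) (fun n => s n.+1 + n.+1%:R^-1).
  move=> n m; have [nm|mn] := leqP n m.
    by apply: (@le_trans _ _ (s m.+1)); [exact: smono|rewrite lerDl invr_ge0].
  by apply: stail; rewrite ltn0Sn ltnW.
exists b; last by case=> // X _; exact: hb.
have /andP[+ _] := hb 0%N; apply: le_trans.
by rewrite sumr_ge0 // => d _; rewrite invr_ge0 exprn_ge0.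
Qed.

(** Since 3 / 4 < 1, the recursion on the bound in [sector_sum_coprime] is a
    contraction: the first term is 1 / 4, and the others telescope to 1 / 2. *)
Lemma sum_inv_sq_from2 (R : realType) (P : pred nat) (X : nat) :
  \sum_(2 <= d < X.+1 | P d) (d%:R : R) ^- 2 <= 3%:R / 4%:R.
Proof.
rewrite big_mkcond; case: X => [|[|X]]; try by rewrite big_geq //; lra.
rewrite big_ltn //= -big_mkcond /=.
have := @sum_inv_sq_tail R P 2 X.+2 isT.
have : 0 <= (X.+2%:R : R)^-1 by rewrite invr_ge0.
have : (if P 2 then (2%:R : R) ^- 2 else 0) <= 4%:R^-1.
  by case: ifP => _; rewrite ?invr_ge0 // -natrX.
have -> : (2%:R : R)^-1 = 1 / 2%:R by rewrite mul1r.
by move: (bigop _ _ _) (X.+2%:R^-1) (if _ then _ else _) => x y z; lra.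
Qed.

(** As ln (2 d) <= 4 sqrt d, the terms are at most 4 / d^(3/2), which is bounded
    by 8 (1 / sqrt (d - 1) - 1 / sqrt d). *)
Lemma sum_ln_over_sq (R : realType) (P : pred nat) (X : nat) :
  \sum_(2 <= d < X.+1 | P d) ln (2 * d)%:R * (d%:R : R) ^- 2 <= 8%:R.
Proof.
case: X => [|X]; first by rewrite big_geq.
suff h : \sum_(2 <= d < X.+2) ln (2 * d)%:R * (d%:R : R) ^- 2 <=
    8%:R * (1 - (Num.sqrt X.+1%:R)^-1).
  apply: (@le_trans _ _ (8%:R * (1 - (Num.sqrt X.+1%:R)^-1))); last first.
    by rewrite -[leRHS]mulr1 ler_wpM2l // gerBl invr_ge0 sqrtr_ge0.
  apply: le_trans h; rewrite big_mkcond big_seq [leRHS]big_seq; apply: ler_sum => d.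
  rewrite mem_index_iota => /andP[d2 _]; case: ifP => // _.
  rewrite mulr_ge0 ?invr_ge0 ?exprn_ge0 //.
  by rewrite ln_ge0 // ler1n; lia.
elim: X => [|X IH]; first by rewrite big_geq // sqrtr1 invr1 subrr mulr0.
rewrite big_nat_recr //=.
set a := Num.sqrt X.+1%:R in IH *; set b := Num.sqrt X.+2%:R.
have a0 : 0 < a by rewrite sqrtr_gt0 ltr0n.
have b0 : 0 < b by rewrite sqrtr_gt0 ltr0n.
have a2 : a ^+ 2 = X.+1%:R by rewrite sqr_sqrtr.
have b2 : b ^+ 2 = X.+2%:R by rewrite sqr_sqrtr.
have ab2 : b ^+ 2 = a ^+ 2 + 1 by rewrite a2 b2 natr1.
have ab : a <= b by rewrite ler_sqrt ?ltr0n // ler_nat.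
have hln : ln (2 * X.+2)%:R <= 4%:R * b.
  apply: (@le_trans _ _ (ln ((2%:R * b) ^+ 2))).
    rewrite ler_ln ?posrE ?ltr0n ?exprn_gt0 ?mulr_gt0 //.
    rewrite exprMn b2 natrM ler_wpM2r // -natrX ler_nat //.
  rewrite lnXn ?mulr_gt0 // mulr2n.
  have := ltW (@ln_sublinear R (2%:R * b) (mulr_gt0 (ltr0Sn _ _) b0)).
  by move: (ln (2%:R * b)) (b) => t u; lra.
apply: le_trans (lerD IH (ler_wpM2r _ hln)) _; first by rewrite invr_ge0 exprn_ge0.
rewrite -b2.
have key : 4%:R * b * (b ^+ 2) ^- 2 <= 8%:R * (a^-1 - b^-1).
  have -> : 4%:R * b * (b ^+ 2) ^- 2 = 4%:R / b ^+ 3 by field; rewrite gt_eqF.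
  have -> : a^-1 - b^-1 = (a * b * (a + b))^-1.
    have h : (b - a) * (a + b) = 1 by rewrite (_ : _ * _ = b ^+ 2 - a ^+ 2); [rewrite ab2|]; ring.
    apply: (mulIf (_ : a * b * (a + b) != 0)); first by rewrite !mulf_neq0 // gt_eqF // addr_gt0.
    rewrite mulVf ?mulf_neq0 ?gt_eqF // ?addr_gt0 // -[RHS]h; field.
    by rewrite !gt_eqF.
  rewrite ler_pdivrMr ?exprn_gt0 // mulrAC ler_pdivlMr ?mulr_gt0 ?addr_gt0 //.
  have : a * b * (a + b) <= 2%:R * b ^+ 3; last lra.
  rewrite (_ : 2%:R * b ^+ 3 = b * b * (b + b)); last by ring.
  by rewrite !ler_pM ?mulr_ge0 ?addr_ge0 ?lerD ?(ltW a0) ?(ltW b0) ?lexx.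
by move: key; move: (4%:R * b * _) (a^-1) (b^-1) => x y z; lra.
Qed.

Lemma ln_divn_bounds (R : realType) (X d : nat) : (0 < d <= X)%N ->
  0 <= ln (X%:R : R) - ln (X %/ d)%:R <= ln (2 * d)%:R.
Proof.
move=> /andP[d0 dX]; have X0 : (0 < X)%N by lia.
have q0 : (0 < X %/ d)%N by rewrite divn_gt0.
apply/andP; split.
  by rewrite subr_ge0 ler_ln ?posrE ?ltr0n // ler_nat leq_div.
rewrite lerBlDr -lnM ?posrE ?ltr0n ?muln_gt0 ?d0 //.
rewrite ler_ln ?posrE -?natrM ?ltr0n ?muln_gt0 ?d0 ?q0 // ler_nat.
have := ltn_ceil X d0; nia.
Qed.

(** Let f(X) be the sum over the coprime pairs of a class.  Sorting all the
    pairs of the class by their gcd gives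
      c0 ln X + O(1) = f(X) + sum over d >= 2 of f'(X / d) / d^2,
    where d is coprime to K and f' is the sum over the coprime pairs of another
    such class.  Inserting c ln X for all these sums determines
    c = c0 / (1 + b), with b the sum of the 1 / d^2.  The error then satisfies a
    recursion with the factor 3 / 4, so it stays bounded, uniformly in the
    class. *)
Lemma sector_sum_coprime (R : realType) (g : R -> R) (L B : R) (K : nat) :
  slope_density g L B -> (0 < K)%N ->
  exists2 c, 0 < c & exists C, forall r1 r2 X,
    coprime (gcdn r1 r2) K -> (0 < X)%N ->
    `|sector_sum g (coprime_class K r1 r2) X - c * ln X%:R| <= C.
Proof.
move=> gd K0; have [c0 c00 [C0 HC0]] := sector_sum_residue_class gd K0.
have [b b0 hb] := @sum_inv_sq_limit R (fun d => coprime d K).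
have b1 : 0 < 1 + b by lra.
pose c := c0 / (1 + b).
have cb : c * (1 + b) = c0 by rewrite divfK // gt_eqF.
have c_gt0 : 0 < c by rewrite divr_gt0.
(* The fixed point of the recursion C0 + 3 / 4 C + 8 c + c for the error. *)
pose C := 4%:R * (C0 + c * 8%:R + c).
have C00 : 0 <= C0 by apply: le_trans (HC0 0%N 0%N 1%N isT); exact: normr_ge0.
have C_ge0 : 0 <= C by rewrite /C; lra.
exists c => //; exists C => r1 r2 X; elim/ltn_ind: X r1 r2 => X IH r1 r2 rK X0.
have lnX0 : 0 <= ln X%:R :> R by rewrite ln_ge0 // ler1n.
pose F d := sector_sum g (fun n i => residue_class K r1 r2 n i && (gcdn n i == d)) X.
have FE d : (2 <= d <= X)%N ->
    `|F d - (if coprime d K then c * ln X%:R / d%:R ^+ 2 else 0)| <=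
    (if coprime d K then C * d%:R ^- 2 + c * (ln (2 * d)%:R * d%:R ^- 2) else 0).
  move=> /andP[d2 dX]; have d0 : (0 < d)%N by lia.
  have dd : (0 : R) < d%:R ^- 2 by rewrite invr_gt0 exprn_gt0 // ltr0n.
  have [s1 [s2 [sK]]] := @sector_sum_gcd_part R g K r1 r2 d X K0 d0 rK.
  rewrite -/(F d) => ->; case: ifP => _; last by rewrite subrr normr0.
  rewrite -mulrBl normrM (gtr0_norm dd).
  rewrite [c * (_ * _)]mulrA -mulrDl ler_wpM2r ?(ltW dd) //.
  rewrite [X in `|X|](_ : _ = (sector_sum g (coprime_class K s1 s2) (X %/ d)
     - c * ln (X %/ d)%:R) + - (c * (ln X%:R - ln (X %/ d)%:R))); last by ring.
  apply: le_trans (ler_normD _ _) _; apply: lerD.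
    by apply: IH; rewrite ?ltn_Pdiv ?divn_gt0.
  have /andP[h1 h2] := @ln_divn_bounds R X d (introT andP (conj d0 dX)).
  rewrite normrN ger0_norm; last by rewrite mulr_ge0 // ltW.
  by rewrite ler_pM2l.
have F1 : F 1%N = sector_sum g (coprime_class K r1 r2) X by [].
have split : sector_sum g (residue_class K r1 r2) X = F 1%N + \sum_(2 <= d < X.+1) F d.
  by rewrite (sector_sum_gcd_split g) big_ltn.
pose bX : R := \sum_(2 <= d < X.+1 | coprime d K) d%:R ^- 2.
have tail : `|\sum_(2 <= d < X.+1) F d - c * ln X%:R * bX| <= C * (3%:R / 4%:R) + c * 8%:R.
  rewrite /bX mulr_sumr [X in _ - X]big_mkcond -sumrB; apply: le_trans (ler_norm_sum _ _ _) _.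
  apply: (@le_trans _ _ (\sum_(2 <= d < X.+1 | coprime d K)
    (C * d%:R ^- 2 + c * (ln (2 * d)%:R * d%:R ^- 2)))).
    rewrite [leRHS]big_mkcond big_seq [leRHS]big_seq; apply: ler_sum => d.
    by rewrite mem_index_iota ltnS; exact: FE.
  rewrite big_split /= -!mulr_sumr; apply: lerD.
    by rewrite ler_wpM2l // sum_inv_sq_from2.
  by rewrite ler_pM2l // sum_ln_over_sq.
have /andP[bX1 bX2] := hb X X0; rewrite -/bX in bX1 bX2.
have lnX : (b - bX) * ln X%:R <= 1.
  have XR : 0 < X%:R :> R by rewrite ltr0n.
  apply: (@le_trans _ _ (X%:R^-1 * X%:R)); last by rewrite mulVf // gt_eqF.
  apply: ler_pM => //; rewrite ?subr_ge0 //; first by rewrite lerBlDl.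
  exact/ltW/ln_sublinear.
have lnX' : 0 <= (b - bX) * ln X%:R by rewrite mulr_ge0 // subr_ge0.
have tot := HC0 r1 r2 X X0; rewrite split in tot.
rewrite -F1 [X in `|X|](_ : _ =
   (F 1%N + \sum_(2 <= d < X.+1) F d - c0 * ln X%:R)
   - (\sum_(2 <= d < X.+1) F d - c * ln X%:R * bX)
   + c * ((b - bX) * ln X%:R)); last by rewrite -cb; ring.
apply: le_trans (ler_normD _ _) _.
apply: le_trans (lerD (ler_normB _ _) (lexx _)) _.
apply: le_trans (lerD (lerD tot tail) (lexx _)) _.
rewrite ger0_norm; last by rewrite mulr_ge0 // ltW.
have h : c * ((b - bX) * ln X%:R) <= c by rewrite -[leRHS]mulr1 ler_pM2l.
apply: le_trans (lerD (lexx _) h) _.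
by rewrite /C; lra.
Qed.

(** A coprime pair lies in a class whose gcd is coprime to K; the sum therefore
    only involves such classes, and each that satisfies P contributes the same
    positive multiple of ln X. *)
Lemma sector_sum_periodic (R : realType) (g : R -> R) (L B : R) (K : nat)
    (P : nat -> nat -> bool) :
  slope_density g L B -> (0 < K)%N ->
  (forall n i n' i', n = n' %[mod K] -> i = i' %[mod K] -> P n i -> P n' i') ->
  exists2 c, 0 <= c /\ (forall n i, P n i -> coprime n i -> 0 < c) &
  exists C, forall X, (0 < X)%N ->
    `|sector_sum g (fun n i => P n i && coprime n i) X - c * ln X%:R| <= C.
Proof.
move=> gd K0 Pper; have [c c0 [C HC]] := sector_sum_coprime gd K0.
pose U (r : 'I_K * 'I_K) := P r.1 r.2 && coprime (gcdn r.1 r.2) K.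
have Punit n i : coprime n i -> coprime (gcdn (n %% K) (i %% K)) K.
  move=> /eqP h; rewrite /coprime -dvdn1 -[X in (_ %| X)%N]h.
  set e := gcdn _ K; have eK : (e %| K)%N := dvdn_gcdr _ _.
  have eg : (e %| gcdn (n %% K) (i %% K))%N := dvdn_gcdl _ _.
  have key m : (e %| m)%N = (e %| m %% K)%N by rewrite /dvdn modn_dvdm.
  rewrite dvdn_gcd (key n) (key i).
  by rewrite (dvdn_trans eg (dvdn_gcdl _ _)) (dvdn_trans eg (dvdn_gcdr _ _)).
exists (\sum_(r | U r) c).
  split; first by rewrite sumr_ge0 // => _ _; exact: ltW.
  move=> n i Pni ni.
  pose r : 'I_K * 'I_K := (Ordinal (ltn_pmod n K0), Ordinal (ltn_pmod i K0)).
  have Ur : U r.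
    by rewrite /U /= Punit // andbT; apply: Pper Pni; rewrite modn_mod.
  rewrite (bigD1 r) //= ltr_wpDr //.
  by rewrite sumr_ge0 // => _ _; exact: ltW.
exists (\sum_(r | U r) C) => X X0.
have -> : sector_sum g (fun n i => P n i && coprime n i) X =
    \sum_(r | U r) sector_sum g (coprime_class K r.1 r.2) X.
  rewrite /sector_sum exchange_big; apply: eq_bigr => n _.
  under [RHS]eq_bigr do rewrite big_mkcond.
  rewrite exchange_big big_mkcond /=; apply: eq_bigr => i _.
  rewrite -big_mkcondr /=.
  pose r : 'I_K * 'I_K := (Ordinal (ltn_pmod n K0), Ordinal (ltn_pmod i K0)).
  have class_r (r' : 'I_K * 'I_K) : residue_class K r'.1 r'.2 n i = (r' == r).
    rewrite /residue_class; case: r' => r1 r2 /=.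
    rewrite xpair_eqE -!val_eqE /= (modn_small (ltn_ord r1)) (modn_small (ltn_ord r2)).
    by rewrite (eq_sym (n %% K)%N) (eq_sym (i %% K)%N).
  case: ifP => [/andP[Pni ni]|nPni].
    rewrite (big_pred1 r) // => r'; rewrite /coprime_class class_r ni andbT.
    have [->|/negPf h] := eqVneq r' r; last by rewrite andbF /= h.
    by rewrite /= eqxx andbT /U /= Punit // andbT; apply: Pper Pni; rewrite modn_mod.
  rewrite big_pred0 // => r'; apply: contraFF nPni => /andP[/andP[Pr _]].
  rewrite /coprime_class class_r => /andP[/eqP r'r ->]; rewrite andbT.
  by apply: Pper Pr; rewrite r'r /= modn_mod.
rewrite mulr_suml -sumrB; apply: le_trans (ler_norm_sum _ _ _) _.
by apply: ler_sum => r /andP[_ rK]; apply: HC.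
Qed.

(** * Points of an arithmetic progression in an interval *)

Lemma size_progression_le (R : realType) (T : eqType) (s : seq T) (k : T -> int)
    (kappa Y : R) :
  uniq s -> {in s &, injective k} -> 0 <= Y ->
  (forall x, x \in s -> `|(k x)%:~R + kappa| < Y) ->
  (size s)%:R <= 2%:R * Y + 1.
Proof.
move=> us injk Y0 hk; have Y20 : 0 <= 2%:R * Y by rewrite mulr_ge0.
pose m := Num.floor (- Y - kappa) + 1.
have /andP[m1 m2] := floor_itv (- Y - kappa); rewrite -/m in m2.
pose f x := absz (k x - m).
have hm x : x \in s -> m <= k x /\ (k x - m)%:~R < 2%:R * Y.
  move=> /hk; rewrite ltr_norml => /andP[h1 h2]; split; last by rewrite intrB; lra.
  by rewrite lezD1 -(ltr_int R); apply: le_lt_trans m1 _; lra.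
have fM x : x \in s -> (f x < (Num.trunc (2%:R * Y)).+1)%N.
  move=> xs; have [h1 h2] := hm x xs.
  rewrite ltnS truncn_ge_nat // /f natr_absz ger0_norm ?subr_ge0 //; exact: ltW.
have : (size s <= (Num.trunc (2%:R * Y)).+1)%N.
  rewrite -(size_map f) -[leqRHS](size_iota 0); apply: uniq_leq_size.
    rewrite map_inj_in_uniq // => x y xs ys; rewrite /f => h; apply: injk => //.
    by have [h1 _] := hm x xs; have [h2 _] := hm y ys; lia.
  by move=> _ /mapP[x xs ->]; rewrite mem_iota add0n fM.
rewrite -(ler_nat R) -natr1 => h; apply: le_trans h _.
by rewrite lerD2r truncn_le.
Qed.

Lemma size_progression_ge (R : realType) (T : eqType) (s : seq T) (k : T -> int)
    (kappa Y : R) :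
  (forall j : int, `|j%:~R + kappa| < Y -> exists2 x, x \in s & k x = j) ->
  2%:R * Y - 2%:R <= (size s)%:R.
Proof.
move=> hk; pose m := Num.floor (- Y - kappa) + 1.
have /andP[m1 m2] := floor_itv (- Y - kappa); rewrite -/m in m2.
have m3 : m%:~R <= - Y - kappa + 1 by rewrite intrD lerD2r.
have [Y1|Y1] := ltP (2%:R * Y - 1) 0.
  by apply: le_trans (ler0n _ _); lra.
pose M := Num.trunc (2%:R * Y - 1).
have hM : 2%:R * Y - 1 < M.+1%:R := truncnS_gt _.
apply: (@le_trans _ _ M%:R); first by rewrite -natr1 in hM; lra.
rewrite ler_nat -(size_iota 0 M).
rewrite -(size_map (fun v => m + v%:Z)) -(size_map k s); apply: uniq_leq_size.
  by rewrite map_inj_uniq ?iota_uniq // => x y /addrI [].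
move=> j /mapP[v]; rewrite mem_iota add0n /= => vM -> {j}.
have [|x xs <-] := hk (m + v%:Z); last exact: map_f.
have : (v.+1)%:R <= 2%:R * Y - 1 :> R by rewrite -truncn_ge_nat.
rewrite -natr1 ltr_norml intrD => hv; have : (0 : R) <= v%:R by [].
by move=> v0; apply/andP; split; lra.
Qed.

(** * Norms on three-dimensional space *)

Section NormOnR3.
Variables (R : realType) (N : 'cV[R]_3 -> R).
Hypothesis normN : is_norm N.

Lemma is_norm0 : N 0 = 0.
Proof. by rewrite -(scale0r (0 : 'cV[R]_3)) (norm_homogeneous normN) normr0 mul0r. Qed.

Lemma is_normN x : N (- x) = N x.
Proof. by rewrite -scaleN1r (norm_homogeneous normN) normrN1 mul1r. Qed.

Lemma is_norm_ge0 x : 0 <= N x.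
Proof.
have := norm_triangle normN x (- x); rewrite subrr is_norm0 is_normN; lra.
Qed.

Lemma is_norm_dist x y : `|N x - N y| <= N (x - y).
Proof.
have := norm_triangle normN (x - y) y; rewrite subrK => h1.
have := norm_triangle normN (y - x) x; rewrite subrK -opprB is_normN => h2.
by rewrite ler_norml; apply/andP; split; lra.
Qed.

Lemma is_norm_sum (x : 'cV[R]_3) :
  N x <= `|x 0 0| * N (delta_mx 0 0) + `|x 1 0| * N (delta_mx 1 0)
         + `|x 2%:R 0| * N (delta_mx 2%:R 0).
Proof.
have {1}-> : x = x 0 0 *: delta_mx 0 0 + x 1 0 *: delta_mx 1 0
    + x 2%:R 0 *: delta_mx 2%:R 0.
  by apply: cV3P; rewrite !mxE /=; ring.
apply: le_trans (norm_triangle normN _ _) _.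
apply: le_trans (lerD (norm_triangle normN _ _) (lexx _)) _.
by rewrite !(norm_homogeneous normN).
Qed.

Lemma entry_le_norm (x : 'rV[R]_3) i : `|x 0 i| <= `|x|.
Proof.
rewrite [leRHS]/Num.norm /= mx_normrE.
by apply/bigmax_geP; right => /=; exists (0, i).
Qed.

Lemma is_norm_le_norm : exists2 C, 0 < C & forall x : 'rV[R]_3, N x^T <= C * `|x|.
Proof.
exists (N (delta_mx 0 0) + N (delta_mx 1 0) + N (delta_mx 2%:R 0) + 1).
  by rewrite ltr_wpDl // !addr_ge0 // is_norm_ge0.
move=> x; apply: le_trans (is_norm_sum _) _; rewrite !mxE mulrDl mul1r.
rewrite ler_wpDr // ![_ * `|x|]mulrC !mulrDr.
by rewrite !lerD // ler_wpM2r ?is_norm_ge0 // entry_le_norm.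
Qed.

Lemma is_norm_continuous : continuous (fun x : 'rV[R]_3 => N x^T).
Proof.
have [C C0 HC] := is_norm_le_norm.
move=> x; apply/(cvgrPdist_lt (FF := nbhs_filter x)) => e e0.
have : \forall y \near x, `|x - y| < e / C.
  apply/nbhs_normP; exists (e / C); first by rewrite /= divr_gt0.
  by move=> y.
apply: filterS => y xy.
apply: le_lt_trans (is_norm_dist _ _) _; rewrite -linearB.
by apply: le_lt_trans (HC _) _; rewrite mulrC -ltr_pdivlMr.
Qed.

(** N attains a positive minimum on the unit sphere of the sup norm, which is
    compact. *)
Lemma is_norm_coercive : exists2 c, 0 < c & forall (x : 'cV[R]_3) i, c * `|x i 0| <= N x.
Proof.
pose S : set 'rV[R]_3 := [set x | `|x| = 1].
have S0 : S !=set0.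
  exists (const_mx 1); rewrite /S /= [LHS]/Num.norm /= mx_normrE.
  apply/eqP; rewrite eq_le; apply/andP; split.
    by apply/bigmax_leP; split=> // i _; rewrite mxE normr1.
  by apply/bigmax_geP; right => /=; exists (0, 0) => //; rewrite mxE normr1.
have cS : compact S.
  apply: bounded_closed_compact.
    by exists 1; split; [exact: num_real|move=> M M1 x /= ->; exact: ltW].
  rewrite (_ : S = (fun x : 'rV[R]_3 => `|x|) @^-1` [set 1]) //.
  apply: closed_comp; last exact: closed_eq.
  by move=> x _; exact: norm_continuous.
have [x0 x0S hx0] := EVT_min_rV S0 cS (continuous_subspaceT is_norm_continuous).
exists (N x0^T).
  rewrite lt_neqAle is_norm_ge0 andbT eq_sym; apply/eqP => /(norm_definite normN).
  move=> /(congr1 trmx); rewrite trmxK trmx0 => x00.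
  by move: x0S; rewrite inE /S /= x00 normr0 => /eqP; rewrite eq_sym oner_eq0.
move=> x i; apply: (@le_trans _ _ (N x0^T * `|x^T|)).
  by rewrite ler_wpM2l ?is_norm_ge0 //; have := entry_le_norm x^T i; rewrite mxE.
have [x00|x00] := eqVneq `|x^T| 0; first by rewrite x00 mulr0 is_norm_ge0.
have xp : 0 < `|x^T| by rewrite lt_neqAle eq_sym x00 normr_ge0.
rewrite -ler_pdivlMr //.
have := hx0 (`|x^T|^-1 *: x^T).
rewrite linearZ /= trmxK (norm_homogeneous normN) ger0_norm ?invr_ge0 // mulrC.
by apply; rewrite inE /S /= normrZ normfV normr_id mulVf.
Qed.

End NormOnR3.

(** * Norms of symmetric products *)

Definition vec3 (A : Type) (x y z : A) : 'cV[A]_3 :=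
  \col_i (if i == 0 then x else if i == 1 then y else z).

(** The coefficients of the product of the linear forms with coefficients p and
    u. *)
Definition sym_prod (A : comNzRingType) (p1 p2 u1 u2 : A) : 'cV[A]_3 :=
  vec3 (p1 * u1) (p2 * u2) (p1 * u2 + p2 * u1).

Lemma vec3E (A : Type) (x y z : A) :
  (vec3 x y z 0 0 = x) * (vec3 x y z 1 0 = y) * (vec3 x y z 2%:R 0 = z).
Proof. by rewrite !mxE. Qed.

(** The two numbers have product (p1 u1) (p2 u2) and a small sum: if one of them
    exceeded 2 m, the other would exceed m, and their product m^2. *)
Lemma sym_prod_entries_bound (R : realType) (p1 p2 u1 u2 m : R) :
  `|p1 * u1| <= m -> `|p2 * u2| <= m -> `|p1 * u2 + p2 * u1| <= m ->
  `|p1 * u2| <= 2%:R * m /\ `|p2 * u1| <= 2%:R * m.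
Proof.
move=> h1 h2 h12; have m0 : 0 <= m by apply: le_trans h1.
have key (x y : R) : `|x + y| <= m -> `|x * y| <= m ^+ 2 -> `|x| <= 2%:R * m.
  move=> hs hp; rewrite leNgt; apply/negP => hx.
  have hy : m < `|y|.
    have : `|x| <= `|x + y| + `|y| by rewrite -{1}(addrK y x); exact: ler_normB.
    lra.
  have : m * (2%:R * m) < `|y| * `|x| by apply: ltr_pM => //; rewrite mulr_ge0.
  rewrite -normrM mulrC; move: hp; rewrite expr2 (mulrC y) => hp h.
  have : 0 <= m * m by rewrite mulr_ge0.
  lra.
have hp : `|p1 * u2 * (p2 * u1)| <= m ^+ 2.
  rewrite (_ : p1 * u2 * _ = (p1 * u1) * (p2 * u2)); last by ring.
  by rewrite normrM expr2 ler_pM.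
split; first exact: key h12 hp.
by apply: (key _ (p1 * u2)); [rewrite addrC|rewrite [_ * (p1 * u2)]mulrC].
Qed.

(** The point of the sector [s] at parameter t on the unit square of the sup
    norm. *)
Definition slope1 (R : realType) (s : bool) (t : R) : R := if s then 1 else t - 1.
Definition slope2 (R : realType) (s : bool) (t : R) : R := if s then 1 - t else 1.

Lemma sector_slope (R : realType) (s : bool) (n i : nat) : (0 < n)%N ->
  (sector1 s n i)%:~R = n%:R * slope1 s (i%:R / n%:R) :> R /\
  (sector2 s n i)%:~R = n%:R * slope2 s (i%:R / n%:R) :> R.
Proof.
move=> n0; have n0R : n%:R != 0 :> R by rewrite pnatr_eq0 -lt0n.
rewrite /sector1 /sector2 /slope1 /slope2; case: s; rewrite ?intrB.
  by split; rewrite ?mulr1 // mulrBr mulr1 mulrC divfK.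
by split; rewrite ?mulr1 // mulrBr mulr1 mulrC divfK.
Qed.

Section SquareNorm.
Variables (R : realType) (N : 'cV[R]_3 -> R).
Hypothesis normN : is_norm N.

Definition square_norm (p1 p2 : R) : R := N (sym_prod p1 p2 p1 p2).

Definition inv_square_norm (s : bool) (t : R) : R :=
  (square_norm (slope1 s t) (slope2 s t))^-1.

Lemma square_norm_scale k p1 p2 :
  square_norm (k * p1) (k * p2) = k ^+ 2 * square_norm p1 p2.
Proof.
rewrite /square_norm (_ : sym_prod _ _ _ _ = k ^+ 2 *: sym_prod p1 p2 p1 p2).
  by rewrite (norm_homogeneous normN) ger0_norm // sqr_ge0.
by apply: cV3P; rewrite !mxE /=; ring.
Qed.

Lemma square_norm_sector s n i : (0 < n)%N ->
  (square_norm (sector1 s n i)%:~R (sector2 s n i)%:~R)^-1 =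
  inv_square_norm s (i%:R / n%:R) / n%:R ^+ 2.
Proof.
move=> n0; have [-> ->] := @sector_slope R s n i n0.
by rewrite square_norm_scale invfM mulrC.
Qed.

Lemma vec3_norm_le x y z : N (vec3 x y z) <=
  `|x| * N (delta_mx 0 0) + `|y| * N (delta_mx 1 0) + `|z| * N (delta_mx 2%:R 0).
Proof. by have := is_norm_sum normN (vec3 x y z); rewrite !vec3E. Qed.

Lemma sector_square_norm_ge : exists2 c, 0 < c & forall s n i, (0 < n)%N ->
  c * n%:R ^+ 2 <= square_norm (sector1 s n i)%:~R (sector2 s n i)%:~R.
Proof.
have [c c0 hc] := is_norm_coercive normN; exists c => // s n i n0.
have := hc (sym_prod (sector1 s n i)%:~R (sector2 s n i)%:~R
  (sector1 s n i)%:~R (sector2 s n i)%:~R).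
rewrite /sector1 /sector2; case: s => h.
  by have := h 0; rewrite vec3E -expr2 ger0_norm ?sqr_ge0.
by have := h 1; rewrite vec3E -expr2 ger0_norm ?sqr_ge0.
Qed.

Lemma inv_square_norm_density : exists L B, forall s,
  slope_density (inv_square_norm s) L B.
Proof.
have [c c0 hc] := is_norm_coercive normN.
pose M : R := N (delta_mx 0 0) + N (delta_mx 1 0) + N (delta_mx 2%:R 0).
have N0 i : 0 <= N (delta_mx i 0) := is_norm_ge0 normN _.
have M0 : 0 <= M by rewrite !addr_ge0.
have lower s t : c <= square_norm (slope1 s t) (slope2 s t).
  have := hc (sym_prod (slope1 s t) (slope2 s t) (slope1 s t) (slope2 s t)).
  rewrite /slope1 /slope2; case: s => h.
    by have := h 0; rewrite vec3E mulr1 normr1 mulr1.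
  by have := h 1; rewrite vec3E mulr1 normr1 mulr1.
have pos s t : 0 < square_norm (slope1 s t) (slope2 s t).
  exact: lt_le_trans c0 (lower s t).
have upper s t : 0 <= t <= 2%:R -> square_norm (slope1 s t) (slope2 s t) <= 2%:R * M + 1.
  move=> /andP[t0 t2]; apply: le_trans (vec3_norm_le _ _ _) _.
  have ht : `|t - 1| <= 1 by rewrite ler_norml; apply/andP; split; lra.
  have ht' : `|1 - t| <= 1 by rewrite distrC.
  have h1 : `|slope1 s t| <= 1 by rewrite /slope1; case: (s); rewrite ?normr1.
  have h2 : `|slope2 s t| <= 1 by rewrite /slope2; case: (s); rewrite ?normr1.
  have hm (x y : R) : `|x| <= 1 -> `|y| <= 1 -> `|x * y| <= 1.
    by move=> hx hy; rewrite normrM -[leRHS]mulr1 ler_pM.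
  have hs : `|slope1 s t * slope2 s t + slope2 s t * slope1 s t| <= 2%:R.
    apply: le_trans (ler_normD _ _) _; have := hm _ _ h1 h2; have := hm _ _ h2 h1; lra.
  apply: le_trans (_ : 2%:R * N (delta_mx 0 0) + 2%:R * N (delta_mx 1 0)
     + 2%:R * N (delta_mx 2%:R 0) <= _); last by rewrite /M; lra.
  by rewrite !lerD // ler_wpM2r // (le_trans (hm _ _ _ _)) // ler1n.
have lip s t t' : 0 <= t <= 2%:R -> 0 <= t' <= 2%:R ->
    `|square_norm (slope1 s t) (slope2 s t) - square_norm (slope1 s t') (slope2 s t')|
    <= 2%:R * M * `|t - t'|.
  move=> /andP[t0 t2] /andP[t'0 t'2]; apply: le_trans (is_norm_dist normN _ _) _.
  pose x := slope1 s t ^+ 2 - slope1 s t' ^+ 2.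
  pose y := slope2 s t ^+ 2 - slope2 s t' ^+ 2.
  pose z := 2%:R * (slope1 s t * slope2 s t - slope1 s t' * slope2 s t').
  rewrite (_ : _ - _ = vec3 x y z); last first.
    by apply: cV3P; rewrite !mxE /= /x /y /z; ring.
  apply: le_trans (vec3_norm_le _ _ _) _.
  have ht : `|t + t' - 2%:R| <= 2%:R by rewrite ler_norml; apply/andP; split; lra.
  have hq : `|(t - t') * (t + t' - 2%:R)| <= 2%:R * `|t - t'|.
    by rewrite normrM mulrC ler_wpM2r.
  have hd : `|2%:R * (t - t')| <= 2%:R * `|t - t'| by rewrite normrM ger0_norm.
  have hd' : 0 <= 2%:R * `|t - t'| by rewrite mulr_ge0.
  have [hx [hy hz]] : `|x| <= 2%:R * `|t - t'| /\ `|y| <= 2%:R * `|t - t'|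
      /\ `|z| <= 2%:R * `|t - t'|.
    rewrite /x /y /z /slope1 /slope2; case: (s).
      rewrite expr1n subrr normr0; split=> //; split.
        by rewrite (_ : _ - _ = (t - t') * (t + t' - 2%:R)) //; ring.
      rewrite (_ : 2%:R * _ = - (2%:R * (t - t'))) ?normrN //; ring.
    rewrite expr1n subrr normr0; split; last split=> //.
      by rewrite (_ : _ - _ = (t - t') * (t + t' - 2%:R)) //; ring.
    rewrite (_ : 2%:R * (_ - _) = 2%:R * (t - t')) //; ring.
  apply: (@le_trans _ _ (2%:R * `|t - t'| * N (delta_mx 0 0)
    + 2%:R * `|t - t'| * N (delta_mx 1 0) + 2%:R * `|t - t'| * N (delta_mx 2%:R 0))).
    by rewrite !lerD // ler_wpM2r.
  by rewrite /M; lra.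
exists (2%:R * M / c ^+ 2), c^-1 => s; split.
- move=> t t' ht ht'; rewrite /inv_square_norm.
  set a := square_norm (slope1 s t) _; set b := square_norm (slope1 s t') _.
  have a0 : 0 < a := pos s t; have b0 : 0 < b := pos s t'.
  rewrite (_ : a^-1 - b^-1 = (b - a) / (a * b)); last by field; rewrite !gt_eqF.
  rewrite normrM [X in _ * X]gtr0_norm ?invr_gt0 ?mulr_gt0 //.
  rewrite [leRHS]mulrAC; apply: ler_pM => //; first by rewrite invr_ge0 mulr_ge0 // ltW.
    by rewrite distrC; exact: lip.
  rewrite lef_pV2 ?posrE ?exprn_gt0 ?mulr_gt0 // expr2.
  by apply: ler_pM; rewrite ?(ltW c0) //; exact: lower.
- by move=> t _; rewrite lef_pV2 ?posrE ?pos // lower.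
- exists (2%:R * M + 1)^-1; first by rewrite invr_gt0 ltr_wpDl // mulr_ge0.
  move=> t ht; rewrite lef_pV2 ?posrE ?pos ?upper //.
  by rewrite ltr_wpDl // mulr_ge0.
Qed.

(** A vector u is the sum of its projection to the line of p, which contributes
    the multiple of p.p, and of a vector orthogonal to p of length
    |det (p, u)| / |p|, whose symmetric product with p is O(det (p, u)). *)
Lemma sym_prod_norm_approx : exists2 C, 0 <= C & forall p1 p2 u1 u2 : R,
  (p1, p2) != (0, 0) ->
  `|N (sym_prod p1 p2 u1 u2)
    - `|(p1 * u1 + p2 * u2) / (p1 ^+ 2 + p2 ^+ 2)| * square_norm p1 p2|
  <= C * `|p1 * u2 - p2 * u1|.
Proof.
pose M : R := N (delta_mx 0 0) + N (delta_mx 1 0) + N (delta_mx 2%:R 0).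
have N0 i : 0 <= N (delta_mx i 0) := is_norm_ge0 normN _.
exists M; first by rewrite !addr_ge0.
move=> p1 p2 u1 u2 p0; set k := _ / _; set D := p1 * u2 - _.
have q0 : 0 < p1 ^+ 2 + p2 ^+ 2.
  rewrite lt_neqAle addr_ge0 ?sqr_ge0 // andbT eq_sym.
  by rewrite paddr_eq0 ?sqr_ge0 // !sqrf_eq0 -xpair_eqE.
rewrite /square_norm -(norm_homogeneous normN k).
apply: le_trans (is_norm_dist normN _ _) _.
rewrite (_ : _ - _ = vec3 (- (p1 * p2 * (D / (p1 ^+ 2 + p2 ^+ 2))))
   (p1 * p2 * (D / (p1 ^+ 2 + p2 ^+ 2)))
   ((p1 ^+ 2 - p2 ^+ 2) * (D / (p1 ^+ 2 + p2 ^+ 2)))); last first.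
  apply: cV3P; rewrite !mxE /= /k /D;
    by field; rewrite gt_eqF.
apply: le_trans (vec3_norm_le _ _ _) _.
have hb (x : R) : `|x| <= p1 ^+ 2 + p2 ^+ 2 ->
    `|x * (D / (p1 ^+ 2 + p2 ^+ 2))| <= `|D|.
  move=> hx; rewrite mulrCA normrM -[leRHS]mulr1 ler_wpM2l //.
  by rewrite normrM normfV (gtr0_norm q0) ler_pdivrMr // mul1r.
have h12 : `|p1 * p2| <= p1 ^+ 2 + p2 ^+ 2.
  rewrite ler_norml; apply/andP; split.
    have := sqr_ge0 (p1 + p2); have := sqr_ge0 p1; have := sqr_ge0 p2; rewrite sqrrD; lra.
  have := sqr_ge0 (p1 - p2); have := sqr_ge0 p1; have := sqr_ge0 p2; rewrite sqrrB; lra.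
have h3 : `|p1 ^+ 2 - p2 ^+ 2| <= p1 ^+ 2 + p2 ^+ 2.
  have := sqr_ge0 p1; have := sqr_ge0 p2.
  by rewrite ler_norml => ? ?; apply/andP; split; lra.
rewrite normrN [leRHS](_ : _ = `|D| * N (delta_mx 0 0) + `|D| * N (delta_mx 1 0)
  + `|D| * N (delta_mx 2%:R 0)); last by rewrite /M; ring.
by rewrite !lerD // ler_wpM2r // hb.
Qed.

End SquareNorm.

(** * Points of the level set as pairs of vectors *)

Definition int_residue (K' : nat) (u : int) : 'I_K'.+1 := inord (absz (u %% K'.+1%:Z)%Z).

Lemma int_residueD K' (u w : int) : int_residue K' (u + K'.+1%:Z * w) = int_residue K' u.
Proof. by rewrite /int_residue addrC mulrC modzMDl. Qed.

Lemma int_residue_eq K' (u u' : int) : int_residue K' u = int_residue K' u' ->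
  exists w, u' = u + K'.+1%:Z * w.
Proof.
move/(congr1 (@nat_of_ord _)); rewrite !inordK; last 2 first.
- by have := @ltz_pmod u K'.+1 isT; have := @modz_ge0 u K'.+1 isT; lia.
- by have := @ltz_pmod u' K'.+1 isT; have := @modz_ge0 u' K'.+1 isT; lia.
have h1 := @modz_ge0 u K'.+1 isT; have h2 := @modz_ge0 u' K'.+1 isT => h.
have {h} h : (u %% K'.+1 = u' %% K'.+1)%Z by lia.
exists ((u' %/ K'.+1)%Z - (u %/ K'.+1)%Z).
by rewrite {1}(divz_eq u' K'.+1) {1}(divz_eq u K'.+1) h; ring.
Qed.

Lemma sector_congr K s n i n' i' : n = n' %[mod K] -> i = i' %[mod K] ->
  exists a1 a2 : int, sector1 s n' i' = sector1 s n i + K%:Z * a1 /\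
    sector2 s n' i' = sector2 s n i + K%:Z * a2.
Proof.
move=> hn hi.
have key m m' : m = m' %[mod K] -> exists a : int, m'%:Z = m%:Z + K%:Z * a.
  move=> h; exists ((m' %/ K)%:Z - (m %/ K)%:Z).
  by rewrite {1}(divn_eq m' K) {1}(divn_eq m K) h !PoszD !PoszM; ring.
have [a ha] := key _ _ hn; have [b hb] := key _ _ hi.
rewrite /sector1 /sector2 ha hb; case: s.
  by exists a, (a - b); split; ring.
by exists (b - a), a; split; ring.
Qed.

Section Representation.
Variables (E F G : 'cV[int]_3) (K : nat) (D : int).
Hypotheses (D0 : 0 < D) (dEFG : \det (cols3 E F G) != 0).

(** The vector K x has the coordinates p.u in the frame E, F, G, where p is the
    primitive vector of index (n, i) in the sector s. *)
Definition represents (x : 'cV[int]_3) (s : bool) (n i : nat) (u1 u2 : int) : Prop :=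
  [/\ (0 < n)%N && (i < 2 * n)%N, coprime n i,
      sector1 s n i * u2 - sector2 s n i * u1 = D &
      K%:Z *: x = cols3 E F G *m sym_prod (sector1 s n i) (sector2 s n i) u1 u2].

Lemma cols3_inj (y z : 'cV[int]_3) :
  cols3 E F G *m y = cols3 E F G *m z -> y = z.
Proof.
move/(congr1 (mulmx (\adj (cols3 E F G)))); rewrite !mulmxA mul_adj_mx.
rewrite !mul_scalar_mx => /matrixP h; apply/matrixP => i j.
by have := h i j; rewrite !mxE => /(mulfI dEFG).
Qed.

Lemma represents_inj x y s n i u1 u2 : (0 < K)%N ->
  represents x s n i u1 u2 -> represents y s n i u1 u2 -> x = y.
Proof.
move=> K0 [_ _ _ h1] [_ _ _ h2]; apply/matrixP => j k.
move: h1; rewrite -h2 => /matrixP/(_ j k); rewrite !mxE.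
by apply: mulfI; rewrite -lt0n.
Qed.

Lemma represents_unique x s n i u1 u2 s' n' i' u1' u2' :
  represents x s n i u1 u2 -> represents x s' n' i' u1' u2' ->
  [/\ s' = s, n' = n, i' = i, u1' = u1 & u2' = u2].
Proof.
move=> [h1 h2 h3 h4] [h1' h2' h3' h4'].
have [b [c hbc]] := sector_bezout s h2; have [b' [c' hbc']] := sector_bezout s' h2'.
move: h4'; rewrite h4 => /cols3_inj/matrixP h.
have e1 := h 0 0; have e2 := h 1 0; have e3 := h 2%:R 0.
rewrite !mxE /= in e1 e2 e3.
have [|||e [ee q1 q2 eu1 eu2]] := rank_one_unique hbc hbc' _ e1 e2 _ _.
- by rewrite h3 gt_eqF.
- lia.
- lia.
have [e1' -> -> ->] := sector_inj ee h1 h1' q1 q2.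
by rewrite eu1 eu2 e1' !mul1r.
Qed.

(** If x is p.u, then -x is u.(-p): the matrix of -x is - u p^T, so the
    primitive vector of -x is u divided by an integer l, and l divides
    det (p, u) = D. *)
Lemma represents_opp x s n i u1 u2 s' n' i' u1' u2' :
  represents x s n i u1 u2 -> represents (- x) s' n' i' u1' u2' ->
  exists l, [/\ l != 0, `|l| <= D, u1 = l * sector1 s' n' i' & u2 = l * sector2 s' n' i'].
Proof.
move=> [h1 h2 h3 h4] [h1' h2' h3' h4'].
have [b [c hbc]] := sector_bezout s h2; have [b' [c' hbc']] := sector_bezout s' h2'.
move: h4'; rewrite scalerN h4 -mulmxN => /cols3_inj/matrixP h.
have e1 := h 0 0; have e2 := h 1 0; have e3 := h 2%:R 0.
rewrite !mxE /= in e1 e2 e3.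
move: h3 h3' hbc hbc' e1 e2 e3.
set p1 := sector1 s n i; set p2 := sector2 s n i.
set q1 := sector1 s' n' i'; set q2 := sector2 s' n' i'.
move=> h3 h3' hbc hbc' e11 e22 e3.
have e12 : q1 * u2' = - (u1 * p2) by lia.
have e21 : q2 * u1' = - (u2 * p1) by lia.
pose l := b' * u1 + c' * u2.
have u1l : u1' = - (l * p1).
  rewrite -[LHS]mul1r -hbc' mulrDl -!mulrA e21 -e11 /l; ring.
have u2l : u2' = - (l * p2).
  rewrite -[LHS]mul1r -hbc' mulrDl -!mulrA e12 -e22 /l; ring.
have hu1 : u1 = l * q1.
  have a1 : u1 * p1 = l * q1 * p1 by move: e11; rewrite u1l; lia.
  have a2 : u1 * p2 = l * q1 * p2 by move: e12; rewrite u2l; lia.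
  rewrite -[LHS]mulr1 -[RHS]mulr1 -hbc.
  by rewrite (_ : u1 * _ = b * (u1 * p1) + c * (u1 * p2)); [rewrite a1 a2|]; ring.
have hu2 : u2 = l * q2.
  have a1 : u2 * p1 = l * q2 * p1 by move: e21; rewrite u1l; lia.
  have a2 : u2 * p2 = l * q2 * p2 by move: e22; rewrite u2l; lia.
  rewrite -[LHS]mulr1 -[RHS]mulr1 -hbc.
  by rewrite (_ : u2 * _ = b * (u2 * p1) + c * (u2 * p2)); [rewrite a1 a2|]; ring.
have hD : l * (p1 * q2 - p2 * q1) = D by rewrite -h3 hu1 hu2; ring.
exists l; split=> //.
  by apply: contraTneq D0 => l0; rewrite -hD l0 mul0r ltxx.
have d0 : p1 * q2 - p2 * q1 != 0.
  by apply: contraTneq D0 => d0; rewrite -hD d0 mulr0 ltxx.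
rewrite -(gtr0_norm D0) -hD normrM; nia.
Qed.

(** Integrality of the coordinates of p.u / K depends only on p and u modulo
    K. *)
Lemma represents_congr x s n i u1 u2 n' i' w1 w2 (a1 a2 : int) :
  represents x s n i u1 u2 -> (0 < n')%N && (i' < 2 * n')%N -> coprime n' i' ->
  sector1 s n' i' = sector1 s n i + K%:Z * a1 ->
  sector2 s n' i' = sector2 s n i + K%:Z * a2 ->
  sector1 s n' i' * (u2 + K%:Z * w2) - sector2 s n' i' * (u1 + K%:Z * w1) = D ->
  exists x', represents x' s n' i' (u1 + K%:Z * w1) (u2 + K%:Z * w2).
Proof.
move=> [h1 h2 h3 h4] h1' h2' s1 s2 h3'.
move: s1 s2 => s1 s2.
exists (x + cols3 E F G *m vec3
  (a1 * u1 + sector1 s n' i' * w1) (a2 * u2 + sector2 s n' i' * w2)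
  (a1 * u2 + a2 * u1 + sector1 s n' i' * w2 + sector2 s n' i' * w1)).
split=> //; rewrite scalerDr h4 scalemxAr -mulmxDr; congr (_ *m _).
by apply: cV3P; rewrite !mxE /= ?s1 ?s2; ring.
Qed.

(** The determinant of (p', u) is congruent to D modulo K; as p' is primitive,
    adding a suitable multiple of K to u makes it equal to D. *)
Lemma represents_same_residue x s n i u1 u2 n' i' :
  represents x s n i u1 u2 -> n = n' %[mod K] -> i = i' %[mod K] ->
  (0 < n')%N && (i' < 2 * n')%N -> coprime n' i' ->
  exists x' w1 w2, represents x' s n' i' (u1 + K%:Z * w1) (u2 + K%:Z * w2).
Proof.
move=> rx hn hi h1' h2'.
have [a1 [a2 [s1 s2]]] := sector_congr s hn hi.
have [_ _ h3 _] := rx.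
have [b [c hbc]] := sector_bezout s h2'.
pose t := a1 * u2 - a2 * u1.
have ht : sector1 s n' i' * u2 - sector2 s n' i' * u1 = D + K%:Z * t.
  by rewrite -h3 s1 s2 /t; ring.
have [|x' hx'] := @represents_congr x s n i u1 u2 n' i' (c * t) (- (b * t)) a1 a2
  rx h1' h2' s1 s2.
  rewrite (_ : _ - _ = (sector1 s n' i' * u2 - sector2 s n' i' * u1)
    - K%:Z * t * (b * sector1 s n' i' + c * sector2 s n' i')); last by ring.
  by rewrite ht hbc; ring.
by exists x', (c * t), (- (b * t)).
Qed.

Lemma represents_translate x s n i u1 u2 (j : int) : represents x s n i u1 u2 ->
  exists x', represents x' s n i (u1 + K%:Z * (j * sector1 s n i))
    (u2 + K%:Z * (j * sector2 s n i)).
Proof.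
move=> rx; have [h1 h2 h3 _] := rx.
apply: (represents_congr (a1 := 0) (a2 := 0) rx h1 h2); rewrite ?mulr0 ?addr0 //.
by rewrite -h3; ring.
Qed.

Lemma represents_line x y s n i u1 u2 w1 w2 (k : int) :
  represents x s n i u1 u2 -> k != 0 ->
  represents y s n i (u1 + k * w1) (u2 + k * w2) ->
  exists j : int, w1 = j * sector1 s n i /\ w2 = j * sector2 s n i.
Proof.
clear D0 dEFG.
move=> [_ h2 h3 _] k0 [_ _ h3' _].
have [b [c hbc]] := sector_bezout s h2.
have hw : sector1 s n i * w2 = sector2 s n i * w1.
  by apply: (mulfI k0); move: h3'; rewrite -h3; lia.
exists (b * w1 + c * w2); split.
  rewrite -[LHS]mulr1 -hbc !mulrDr (_ : w1 * (c * _) = c * (sector2 s n i * w1)); last by ring.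
  by rewrite -hw; ring.
rewrite -[LHS]mulr1 -hbc !mulrDr (_ : w2 * (b * _) = b * (sector1 s n i * w2)); last by ring.
by rewrite hw; ring.
Qed.

End Representation.

(** * Counting the level set along lines *)

(** The coordinate of the orthogonal projection of u to the line of p, with p
    as the unit. *)
Definition line_coord (R : realType) (s : bool) (n i : nat) (u1 u2 : int) : R :=
  ((sector1 s n i)%:~R * u1%:~R + (sector2 s n i)%:~R * u2%:~R) /
  ((sector1 s n i)%:~R ^+ 2 + (sector2 s n i)%:~R ^+ 2).

Lemma sector_sq_ge (R : realType) s n i :
  n%:R ^+ 2 <= (sector1 s n i)%:~R ^+ 2 + (sector2 s n i)%:~R ^+ 2 :> R.
Proof.
by rewrite /sector1 /sector2; case: s; rewrite ?lerDl ?lerDr sqr_ge0.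
Qed.

Lemma sector_le (R : realType) s n i : (i < 2 * n)%N ->
  `|(sector1 s n i)%:~R| <= n%:R :> R /\ `|(sector2 s n i)%:~R| <= n%:R :> R.
Proof.
move=> h; rewrite /sector1 /sector2 -!intr_norm.
by case: s; split; rewrite -[n%:R]/(n%:Z%:~R) ler_int; lia.
Qed.

Lemma line_coord_translate (R : realType) s n i u1 u2 (k : int) : (0 < n)%N ->
  line_coord R s n i (u1 + k * sector1 s n i) (u2 + k * sector2 s n i) =
  line_coord R s n i u1 u2 + k%:~R.
Proof.
move=> n0; rewrite /line_coord !intrD !intrM; field.
by rewrite gt_eqF // (lt_le_trans _ (sector_sq_ge R s n i)) // exprn_gt0 // ltr0n.
Qed.

Lemma line_coord_le (R : realType) s n i u1 u2 (U : R) : (0 < n)%N -> (i < 2 * n)%N ->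
  `|u1%:~R| <= U -> `|u2%:~R| <= U -> `|line_coord R s n i u1 u2| <= 2%:R * U / n%:R.
Proof.
move=> n0 hi h1 h2; have nR : 0 < n%:R :> R by rewrite ltr0n.
have U0 : 0 <= U by apply: le_trans h1.
have q0 := sector_sq_ge R s n i.
have n20 : 0 < n%:R ^+ 2 :> R by rewrite exprn_gt0.
have [s1 s2] := sector_le R s hi.
rewrite /line_coord normrM normfV.
rewrite [X in _ * X^-1]ger0_norm; last by apply: le_trans q0; apply: ltW.
apply: (@le_trans _ _ (2%:R * U * n%:R / n%:R ^+ 2)).
  apply: ler_pM => //; first by rewrite invr_ge0; apply: le_trans q0; apply: ltW.
    apply: le_trans (ler_normD _ _) _; rewrite !normrM.
    have := ler_pM (normr_ge0 _) (normr_ge0 _) s1 h1.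
    have := ler_pM (normr_ge0 _) (normr_ge0 _) s2 h2.
    lra.
  by rewrite lef_pV2 ?posrE // (lt_le_trans n20).
by rewrite le_eqVlt; apply/orP; left; apply/eqP; field; rewrite gt_eqF.
Qed.

(** Inclusion-exclusion up to the elements on which p and q agree. *)
Lemma count_agree (T : Type) (p q : pred T) (s : seq T) :
  (size s <= count p s + count q s + count (fun x => p x == q x) s)%N /\
  (count p s + count q s <= size s + count (fun x => p x == q x) s)%N.
Proof.
elim: s => //= x s; move: (size s) (count p s) (count q s) (count _ s) => A B C E [].
by case: (p x); case: (q x) => /=; split; lia.
Qed.

Section Count.
Variables (R : realType) (a : 'M[int]_3) (v0 : 'cV[int]_3) (N : 'cV[R]_3 -> R).
Variables (E F G : 'cV[int]_3) (K' : nat) (D : int).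
Hypotheses (normN : is_norm N) (D0 : 0 < D) (dEFG : \det (cols3 E F G) != 0).
Local Notation K := K'.+1.
Local Notation represents := (represents E F G K D).
Hypothesis level_represents : forall x, qform a x = qform a v0 ->
  exists s n i u1 u2, represents x s n i u1 u2.
Hypothesis represents_level : forall x s n i u1 u2,
  represents x s n i u1 u2 -> qform a x = qform a v0.

(** The given norm in the coordinates in which the points are symmetric
    products, so that N x is [frame_norm (p.u)]. *)
Definition frame_norm (y : 'cV[R]_3) : R :=
  K%:R^-1 * N (map_mx intr (cols3 E F G) *m y).

Lemma is_norm_frame : is_norm frame_norm.
Proof.
have KR : 0 < K%:R^-1 :> R by rewrite invr_gt0 ltr0n.
split.
- move=> x y; rewrite /frame_norm mulmxDr -mulrDr ler_pM2l //.
  exact: norm_triangle.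
- by move=> r x; rewrite /frame_norm -scalemxAr (norm_homogeneous normN) mulrCA.
- move=> x /eqP; rewrite mulf_eq0 gt_eqF //= => /eqP/(norm_definite normN) h.
  have u : map_mx intr (cols3 E F G) \in (unitmx : {pred 'M[R]_3}).
    by rewrite unitmxE det_map_mx unitfE intr_eq0.
  by rewrite -[x](mulKmx u) h mulmx0.
Qed.

Lemma norm_represents x s n i u1 u2 : represents x s n i u1 u2 ->
  N (int_vec R x) = frame_norm (sym_prod (sector1 s n i)%:~R (sector2 s n i)%:~R
    u1%:~R u2%:~R).
Proof.
move=> [_ _ _ h]; rewrite /frame_norm.
have -> : sym_prod (sector1 s n i)%:~R (sector2 s n i)%:~R u1%:~R u2%:~R =
    int_vec R (sym_prod (sector1 s n i) (sector2 s n i) u1 u2).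
  by apply: cV3P; rewrite !mxE /= ?intrD ?intrM.
rewrite /int_vec -map_mxM -h map_mxZ (norm_homogeneous normN).
by rewrite ger0_norm ?ler0n // mulKf // pnatr_eq0.
Qed.

Lemma representation_data :
  exists (sx : 'cV[int]_3 -> bool) (nx ix : 'cV[int]_3 -> nat)
    (u1x u2x : 'cV[int]_3 -> int), forall x, qform a x = qform a v0 ->
  represents x (sx x) (nx x) (ix x) (u1x x) (u2x x).
Proof.
have /choice[f hf] : forall x, exists d : bool * nat * nat * int * int,
    qform a x = qform a v0 -> represents x d.1.1.1.1 d.1.1.1.2 d.1.1.2 d.1.2 d.2.
  move=> x; have [h|h] := pselect (qform a x = qform a v0).
    have [s [n [i [u1 [u2 r]]]]] := level_represents h.
    by exists (s, n, i, u1, u2).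
  by exists (true, 0%N, 0%N, 0, 0).
exists (fun x => (f x).1.1.1.1), (fun x => (f x).1.1.1.2), (fun x => (f x).1.1.2).
by exists (fun x => (f x).1.2), (fun x => (f x).2).
Qed.

Section WithData.
Variables (sx : 'cV[int]_3 -> bool) (nx ix : 'cV[int]_3 -> nat).
Variables (u1x u2x : 'cV[int]_3 -> int).
Hypothesis level_data : forall x, qform a x = qform a v0 ->
  represents x (sx x) (nx x) (ix x) (u1x x) (u2x x).

Lemma data_unique x s n i u1 u2 : represents x s n i u1 u2 ->
  [/\ sx x = s, nx x = n, ix x = i, u1x x = u1 & u2x x = u2].
Proof.
move=> r; exact: (represents_unique D0 dEFG r (level_data (represents_level r))).
Qed.

(** The residues t of u for which the congruence conditions modulo K can be
    met; stated through one solution, since a solution for (n, i) transfers to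
    all the primitive vectors of the same class. *)
Definition admissible (s : bool) (t : 'I_K * 'I_K) (n i : nat) : bool :=
  `[< exists x n0 i0 u1 u2, represents x s n0 i0 u1 u2 /\
      [/\ n0 = n %[mod K], i0 = i %[mod K], int_residue K' u1 = t.1
         & int_residue K' u2 = t.2] >].

Lemma admissible_periodic s t n i n' i' : n = n' %[mod K] -> i = i' %[mod K] ->
  admissible s t n i -> admissible s t n' i'.
Proof.
move=> hn hi /asboolP[x [n0 [i0 [u1 [u2 [r [h1 h2 h3 h4]]]]]]]; apply/asboolP.
by exists x, n0, i0, u1, u2; split=> //; split=> //; rewrite ?h1 ?h2.
Qed.

Definition fiber (S : seq 'cV[int]_3) (s : bool) (t : 'I_K * 'I_K) (n i : nat) :=
  [seq x <- S | [&& sx x == s, nx x == n, ix x == i,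
     int_residue K' (u1x x) == t.1 & int_residue K' (u2x x) == t.2]].

Definition level_seq (S : seq 'cV[int]_3) (T : R) :=
  uniq S /\ (forall x, (x \in S) <-> (qform a x = qform a v0 /\ N (int_vec R x) < T)).

(** The weight 1 / nu(p) of the progression of p and t, or 0 when there is no
    such progression. *)
Definition fiber_main (s : bool) (t : 'I_K * 'I_K) (n i : nat) : R :=
  if [&& (0 < n)%N, (i < 2 * n)%N, coprime n i & admissible s t n i] then
    inv_square_norm frame_norm s (i%:R / n%:R) / n%:R ^+ 2 else 0.

Lemma fiber_empty S T s t n i : level_seq S T ->
  ~~ [&& (0 < n)%N, (i < 2 * n)%N, coprime n i & admissible s t n i] ->
  fiber S s t n i = [::].
Proof.
move=> [_ hS]; apply: contraNeq; rewrite -size_eq0 -lt0n -has_predT => /hasP[x].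
rewrite mem_filter => /andP[/and5P[/eqP h1 /eqP h2 /eqP h3 /eqP h4 /eqP h5] /hS[lx _]] _.
have r := level_data lx; rewrite h1 h2 h3 in r.
have [/andP[-> ->] -> _ _] := r; apply/asboolP.
by exists x, n, i, (u1x x), (u2x x).
Qed.

(** Two vectors u with the same determinant against p and the same residue
    modulo K differ by a multiple of K p. *)
Lemma fiber_parametrization S T s t n i : level_seq S T ->
  [&& (0 < n)%N, (i < 2 * n)%N, coprime n i & admissible s t n i] ->
  exists x u1 u2, [/\ represents x s n i u1 u2, int_residue K' u1 = t.1,
    int_residue K' u2 = t.2 &
    exists k : 'cV[int]_3 -> int, forall y, y \in fiber S s t n i ->
      u1x y = u1 + (K%:Z * k y) * sector1 s n i /\
      u2x y = u2 + (K%:Z * k y) * sector2 s n i].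
Proof.
move=> [_ hS] /and4P[n0 hi ni /asboolP[x [n1 [i1 [u1 [u2 [r [h1 h2 h3 h4]]]]]]]].
have n0i : (0 < n)%N && (i < 2 * n)%N by rewrite n0.
have [x' [w1 [w2 r']]] := represents_same_residue r h1 h2 n0i ni.
exists x', (u1 + K%:Z * w1), (u2 + K%:Z * w2).
split; rewrite ?int_residueD //.
have /choice[k hk] : forall y, exists j : int, y \in fiber S s t n i ->
      u1x y = u1 + K%:Z * w1 + K%:Z * (j * sector1 s n i) /\
      u2x y = u2 + K%:Z * w2 + K%:Z * (j * sector2 s n i).
  move=> y.
have [yS|yS] := boolP (y \in fiber S s t n i); last by exists 0.
move: yS; rewrite mem_filter => /andP[/and5P[/eqP e1 /eqP e2 /eqP e3 /eqP e4 /eqP e5] /hS[ly _]].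
have ry := level_data ly; rewrite e1 e2 e3 in ry.
have [z1 hz1] := int_residue_eq (etrans (etrans (int_residueD _ u1 w1) h3) (esym e4)).
have [z2 hz2] := int_residue_eq (etrans (etrans (int_residueD _ u2 w2) h4) (esym e5)).
rewrite hz1 hz2 in ry.
have K00 : K%:Z != 0 by [].
have [j [j1 j2]] := represents_line r' K00 ry.
by exists j => _; rewrite hz1 hz2 j1 j2.
by exists k => y /hk; rewrite !mulrA.
Qed.

(** Along the progression u0 + k K p the norm of the point is |k + kappa| K nu
    up to a bounded error, so the condition N x < T confines k to an interval
    of length 2 T / (K nu) + O(1 / nu), where nu is bounded below. *)
Lemma fiber_count : exists2 C, 0 <= C & forall S T s t n i,
  0 < T -> level_seq S T ->
  `|(size (fiber S s t n i))%:R - 2%:R * T / K%:R * fiber_main s t n i| <= C.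
Proof.
have [c c0 hc] := sector_square_norm_ge is_norm_frame.
have [M M0 hM] := sym_prod_norm_approx is_norm_frame.
have KR : 0 < K%:R :> R by rewrite ltr0n.
have DR : 0 < D%:~R :> R by rewrite ltr0z.
pose e : R := M * D%:~R.
have e0 : 0 <= e by rewrite mulr_ge0 // ltW.
have C0 : 0 <= 2%:R * (e / c) + 2%:R by rewrite addr_ge0 // mulr_ge0 // divr_ge0 // ltW.
exists (2%:R * (e / c) + 2%:R) => // S T s t n i T0 hST.
have [valid|invalid] := boolP [&& (0 < n)%N, (i < 2 * n)%N, coprime n i & admissible s t n i];
  last first.
  by rewrite (fiber_empty hST invalid) /fiber_main (negPf invalid) mulr0 subr0 normr0.
have [x0 [u1 [u2 [r0 h1 h2 [k hk]]]]] := fiber_parametrization hST valid.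
rewrite /fiber_main valid; have /and4P[n0 hi ni _] := valid.
set p1 := sector1 s n i in r0 hk *; set p2 := sector2 s n i in r0 hk *.
pose nu := square_norm frame_norm (p1%:~R) (p2%:~R).
rewrite -(square_norm_sector is_norm_frame s i n0) -/nu.
have nuc : c <= nu.
  apply: le_trans (hc s n i n0); rewrite -[leLHS]mulr1 ler_pM2l //.
  by rewrite exprn_ege1 // ler1n.
have nu0 : 0 < nu by apply: lt_le_trans nuc.
have [b [b' hbb]] := sector_bezout s ni.
have p0 : (p1%:~R, p2%:~R) != (0, 0) :> R * R.
  rewrite xpair_eqE !intr_eq0; apply: contraPN hbb => /andP[/eqP p10 /eqP p20].
  by rewrite -/p1 -/p2 p10 p20 !mulr0 addr0 => /eqP; rewrite eq_sym oner_eq0.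
have near_line w1 w2 x : represents x s n i w1 w2 ->
    `|N (int_vec R x) - `|line_coord R s n i w1 w2| * nu| <= e.
  move=> r; rewrite (norm_represents r).
  have [_ _ hD _] := r; apply: le_trans (hM _ _ _ _ p0) _.
  by rewrite -!intrM -intrB hD gtr0_norm // ltr0z.
pose kappa := line_coord R s n i u1 u2 / K%:R.
have coordE (w1 w2 j : int) : w1 = u1 + (K%:Z * j) * p1 -> w2 = u2 + (K%:Z * j) * p2 ->
    `|j%:~R + kappa| * (nu * K%:R) = `|line_coord R s n i w1 w2| * nu.
  move=> -> ->; rewrite line_coord_translate // intrM mulrCA mulrC; congr (_ * _).
  rewrite -{1}(gtr0_norm KR) -normrM; congr `|_|.
  by rewrite /kappa; field; rewrite ?natr1 ?nat1r gt_eqF.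
have nuK : 0 < nu * K%:R by rewrite mulr_gt0.
have [uS hS] := hST.
have up : (size (fiber S s t n i))%:R <= 2%:R * ((T + e) / (nu * K%:R)) + 1.
  apply: (@size_progression_le R _ _ k kappa).
  - by rewrite filter_uniq.
  - move=> y z yf zf kyz; have [y1 y2] := hk y yf; have [z1 z2] := hk z zf.
    move: yf zf; rewrite !mem_filter => /andP[/and5P[/eqP e1 /eqP e2 /eqP e3 _ _] /hS[ly _]].
    move=> /andP[/and5P[/eqP f1 /eqP f2 /eqP f3 _ _] /hS[lz _]].
    have ry := level_data ly; have rz := level_data lz.
    rewrite e1 e2 e3 y1 y2 kyz in ry; rewrite f1 f2 f3 z1 z2 in rz.
    exact: (represents_inj _ ry rz).
  - by rewrite divr_ge0 ?(ltW nuK) // addr_ge0 // ltW.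
  move=> y yf; have [y1 y2] := hk y yf.
  move: yf; rewrite mem_filter => /andP[/and5P[/eqP e1 /eqP e2 /eqP e3 _ _] /hS[ly NT]].
  have ry := level_data ly; rewrite e1 e2 e3 in ry.
  rewrite ltr_pdivlMr // (coordE _ _ _ y1 y2).
  have := near_line _ _ _ ry; rewrite ler_norml => /andP[h _]; lra.
have low : 2%:R * ((T - e) / (nu * K%:R)) - 2%:R <= (size (fiber S s t n i))%:R.
  apply: (@size_progression_ge R _ _ k kappa) => j.
  rewrite ltr_pdivlMr // => hj.
  have [x rx] := represents_translate j r0.
  have [e1 e2 e3 e4 e5] := data_unique rx.
  have xf : x \in fiber S s t n i.
    rewrite mem_filter e1 e2 e3 e4 e5 !int_residueD h1 h2 !eqxx /=.
    apply/hS; split; first exact: represents_level rx.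
    have := near_line _ _ _ rx; rewrite ler_norml => /andP[_ h].
    have cE := coordE (u1 + K%:Z * (j * p1)) (u2 + K%:Z * (j * p2)) j.
    rewrite cE in hj; [|by rewrite mulrA|by rewrite mulrA].
    by move: h hj; move: (`|line_coord _ _ _ _ _ _| * nu) => z; lra.
  exists x => //; have [y1 y2] := hk x xf.
  have hj1 : k x * p1 = j * p1.
    have /mulfI : K%:Z != 0 by [].
    by apply; apply: (addrI u1); rewrite mulrA -y1 e4.
  have hj2 : k x * p2 = j * p2.
    have /mulfI : K%:Z != 0 by [].
    by apply; apply: (addrI u2); rewrite mulrA -y2 e5.
  rewrite -[LHS]mulr1 -[RHS]mulr1 -hbb -/p1 -/p2.
  by rewrite (_ : k x * _ = b * (k x * p1) + b' * (k x * p2)); [rewrite hj1 hj2|]; ring.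
have ec : e / (nu * K%:R) <= e / c.
  rewrite ler_wpM2l // lef_pV2 ?posrE // -[leLHS]mulr1.
  by apply: ler_pM => //; [exact: ltW|rewrite ler1n].
have eqT : 2%:R * T / K%:R * nu^-1 = 2%:R * (T / (nu * K%:R)).
  by field; rewrite ?natr1 ?nat1r !gt_eqF.
rewrite eqT; move: up low ec; rewrite !mulrDl mulNr.
move: (T / _) (e / (_ * _)) (e / c) (_%:R) => A1 A2 A3 A4 up low ec.
by rewrite ler_norml; apply/andP; split; lra.
Qed.

Lemma fiber_main_sum s t X :
  \sum_(ni : 'I_X.+1 * 'I_(2 * X).+1) fiber_main s t ni.1 ni.2 =
  sector_sum (inv_square_norm frame_norm s)
    (fun n i => admissible s t n i && coprime n i) X.
Proof.
rewrite -(pair_bigA _ (fun (n : 'I_X.+1) (i : 'I_(2 * X).+1) => fiber_main s t n i)) /=.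
rewrite /sector_sum; apply: eq_bigr => n _.
have nX : (2 * n <= (2 * X).+1)%N by have := ltn_ord n; lia.
rewrite (big_ord_widen_cond _ (fun i => admissible s t n i && coprime n i)
  (fun i => inv_square_norm frame_norm s (i%:R / n%:R) / n%:R ^+ 2) nX).
rewrite [RHS]big_mkcond /=; apply: eq_bigr => i _; rewrite /fiber_main.
congr (if _ then _ else _); have [n0|n0] := posnP (n : nat).
  by rewrite n0 /= andbF.
by rewrite /= [coprime _ _ && _]andbC andbC.
Qed.

Lemma small_height_fibers S T X : level_seq S T ->
  (count (fun x => (nx x <= X)%N) S)%:R =
  \sum_(st : bool * ('I_K * 'I_K)) \sum_(ni : 'I_X.+1 * 'I_(2 * X).+1)
    (size (fiber S st.1 st.2 ni.1 ni.2))%:R :> R.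
Proof.
move=> [_ hS]; rewrite pair_bigA /= -natr_sum; congr _%:R.
rewrite -sum1_count.
pose key x : (bool * ('I_K * 'I_K)) * ('I_X.+1 * 'I_(2 * X).+1) :=
  ((sx x, (int_residue K' (u1x x), int_residue K' (u2x x))), (inord (nx x), inord (ix x))).
rewrite (partition_big key xpredT) //=; apply: eq_bigr => -[[s [t1 t2]] [n i]] _ /=.
rewrite sum1_count size_filter; apply: eq_in_count => x /hS[lx _] /=.
have [/andP[_ hi] _ _ _] := level_data lx.
rewrite /key !xpair_eqE.
have [nX|nX] := leqP (nx x) X; last first.
  rewrite /=; apply/esym; apply: contraTF nX => /and5P[_ /eqP -> _ _ _].
  by rewrite -leqNgt -ltnS.
have hn : (inord (nx x) == n) = (nx x == n).
  by rewrite -val_eqE /= inordK.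
have hi' : (inord (ix x) == i) = (ix x == i).
  rewrite -val_eqE /= inordK //; lia.
rewrite hn hi' /= -!andbA; case: (sx x == s) => //=.
by do ! case: (_ == _).
Qed.

Hypothesis base_point : represents v0 true 1 1 0 D.

Lemma small_height_count : exists2 c, 0 < c & exists C, forall S T X,
  0 < T -> (0 < X)%N -> level_seq S T ->
  `|(count (fun x => (nx x <= X)%N) S)%:R - 2%:R * T / K%:R * (c * ln X%:R)|
    <= C * (X%:R ^+ 2 + T).
Proof.
have [C1 C10 hC1] := fiber_count.
have [L [B dens]] := inv_square_norm_density is_norm_frame.
have per (st : bool * ('I_K * 'I_K)) : exists cC : R * R,
    [/\ 0 <= cC.1, forall n i, admissible st.1 st.2 n i -> coprime n i -> 0 < cC.1 &
     forall X, (0 < X)%N -> `|sector_sum (inv_square_norm frame_norm st.1)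
       (fun n i => admissible st.1 st.2 n i && coprime n i) X - cC.1 * ln X%:R| <= cC.2].
  have [c [c0 cpos] [C hC]] := sector_sum_periodic (dens st.1) (ltn0Sn K')
    (@admissible_periodic st.1 st.2).
  by exists (c, C).
have /choice[f hf] := per.
have KR : 0 < K%:R :> R by rewrite ltr0n.
exists (\sum_st (f st).1).
  pose st0 := (true, (int_residue K' 0, int_residue K' D)).
  rewrite (bigD1 st0) //= ltr_wpDr //.
    by rewrite sumr_ge0 // => st _; have [] := hf st.
  have [_ h _] := hf st0; apply: (h 1%N 1%N) => //.
  by apply/asboolP; exists v0, 1%N, 1%N, 0, D.
pose C2 : R := \sum_st (f st).2.
pose C3 : R := 2%:R / K%:R * C2.
pose C4 : R := C1 * #|{: bool * ('I_K * 'I_K)}|%:R * 6%:R.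
have C20 : 0 <= C2.
  by apply: sumr_ge0 => st _; have [_ _ h] := hf st; apply: le_trans (h 1%N isT); exact: normr_ge0.
have C30 : 0 <= C3 by rewrite mulr_ge0 // divr_ge0 // ltW.
have C40 : 0 <= C4 by rewrite !mulr_ge0.
exists (C3 + C4) => S T X T0 X0 hST.
rewrite (small_height_fibers X hST).
set m := 2%:R * T / K%:R.
have m0 : 0 <= m by rewrite divr_ge0 ?mulr_ge0 // ltW.
rewrite (_ : _ - _ = \sum_(st : bool * ('I_K * 'I_K)) \sum_(ni : 'I_X.+1 * 'I_(2 * X).+1)
      ((size (fiber S st.1 st.2 ni.1 ni.2))%:R - m * fiber_main st.1 st.2 ni.1 ni.2)
  + m * \sum_st (sector_sum (inv_square_norm frame_norm st.1)
       (fun n i => admissible st.1 st.2 n i && coprime n i) X - (f st).1 * ln X%:R)); last first.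
  rewrite [X in _ = X + _](eq_bigr (fun st => \sum_(ni : 'I_X.+1 * 'I_(2 * X).+1)
    (size (fiber S st.1 st.2 ni.1 ni.2))%:R - m *
    sector_sum (inv_square_norm frame_norm st.1)
       (fun n i => admissible st.1 st.2 n i && coprime n i) X)); last first.
    by move=> st _; rewrite sumrB -mulr_sumr fiber_main_sum.
  by rewrite !sumrB -mulr_sumr -mulr_suml; ring.
apply: le_trans (ler_normD _ _) _.
have h1 : m * C2 = C3 * T by rewrite /m /C3; field; rewrite ?natr1 ?nat1r gt_eqF.
have X1R : 1 <= X%:R :> R by rewrite ler1n.
apply: (@le_trans _ _ (C4 * X%:R ^+ 2 + C3 * T)); last first.
  rewrite mulrDl !mulrDr.
  have := mulr_ge0 C30 (sqr_ge0 X%:R); have := mulr_ge0 C40 (ltW T0); lra.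
apply: lerD; last first.
  rewrite -h1 normrM ger0_norm // ler_wpM2l //.
  apply: le_trans (ler_norm_sum _ _ _) _; apply: ler_sum => st _.
  by have [_ _ h] := hf st; apply: h.
apply: le_trans (ler_norm_sum _ _ _) _.
apply: (@le_trans _ _ (\sum_(st : bool * ('I_K * 'I_K)) C1 * 6%:R * X%:R ^+ 2)); last first.
  by rewrite sumr_const -[leLHS]mulr_natl /C4 le_eqVlt; apply/orP; left; apply/eqP; ring.
apply: ler_sum => st _; apply: le_trans (ler_norm_sum _ _ _) _.
apply: (@le_trans _ _ (\sum_(ni : 'I_X.+1 * 'I_(2 * X).+1) C1)).
  by apply: ler_sum => ni _; apply: hC1.
rewrite sumr_const card_prod !card_ord -[leLHS]mulr_natl mulrC -mulrA ler_wpM2l //.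
rewrite -natrX -natrM ler_nat; nia.
Qed.

(** The u in question form a progression of direction p, and |p| >= n, so an
    interval of length O(X / n) contains their parameters. *)
Lemma thin_fiber_count S (X : nat) s n i : uniq S ->
  (forall x, x \in S -> [/\ qform a x = qform a v0, sx x = s /\ nx x = n, ix x = i,
     `|u1x x| <= X%:Z & `|u2x x| <= X%:Z]) ->
  (size S)%:R <= (if (0 < n)%N && (i < 2 * n)%N then 4%:R * X%:R / n%:R + 3%:R else 0 : R).
Proof.
move=> uS hS; have [->|Sn] := eqVneq S [::].
  by case: ifP => // _; rewrite addr_ge0 // divr_ge0 // mulr_ge0.
have [y yS] : exists y, y \in S.
  by case: (S) Sn => // z S' _; exists z; rewrite mem_head.
have data z : z \in S -> represents z s n i (u1x z) (u2x z).
  by move=> /hS[lz [e1 e2] e3 _ _]; rewrite -e1 -e2 -e3; exact: level_data.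
have ry := data y yS; have [ni0 ni _ _] := ry; rewrite ni0.
have /andP[n0 hi] := ni0; have nR : 0 < n%:R :> R by rewrite ltr0n.
have [b [b' hb]] := sector_bezout s ni.
pose k z := b * (u1x z - u1x y) + b' * (u2x z - u2x y).
have hk z : z \in S -> u1x z = u1x y + k z * sector1 s n i /\
    u2x z = u2x y + k z * sector2 s n i.
  move=> zS; have rz := data z zS.
  have rz' : represents z s n i (u1x y + 1 * (u1x z - u1x y)) (u2x y + 1 * (u2x z - u2x y)).
    by rewrite !mul1r !subrKC.
  have [j [j1 j2]] := represents_line ry (oner_neq0 _) rz'.
  have kj : k z = j by rewrite /k j1 j2 -[RHS]mulr1 -hb; ring.
  by rewrite kj -j1 -j2 !subrKC.
apply: le_trans (_ : 2%:R * (2%:R * X%:R / n%:R + 1) + 1 <= _); last first.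
  by rewrite -[4%:R]/((2 * 2)%:R) natrM; lra.
apply: (@size_progression_le R _ _ k (line_coord R s n i (u1x y) (u2x y))) => //.
- move=> x z xS zS kxz; have [x1 x2] := hk x xS; have [z1 z2] := hk z zS.
  have rx := data x xS; have rz := data z zS.
  rewrite x1 x2 kxz in rx; rewrite z1 z2 in rz.
  exact: (represents_inj _ rx rz).
move=> x xS; have [x1 x2] := hk x xS; have [_ _ _ h1 h2] := hS x xS.
rewrite addrC -line_coord_translate // -x1 -x2.
apply: le_lt_trans (_ : 2%:R * X%:R / n%:R < _); last by rewrite ltrDl.
by apply: line_coord_le => //; rewrite -intr_norm -[X%:R]/(X%:Z%:~R) ler_int.
Qed.

(** There are O(n) vectors p of sup norm n, each with O(X / n + 1) vectors
    u. *)
Lemma thin_count S (X : nat) : uniq S -> (0 < X)%N ->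
  (forall x, x \in S -> [/\ qform a x = qform a v0, (nx x <= X)%N,
     `|u1x x| <= X%:Z & `|u2x x| <= X%:Z]) ->
  (size S)%:R <= 56%:R * (X%:R : R) ^+ 2.
Proof.
move=> uS X0 hS; have X1R : 1 <= X%:R :> R by rewrite ler1n.
pose key x : bool * ('I_X.+1 * 'I_(2 * X).+1) := (sx x, (inord (nx x), inord (ix x))).
pose bound (n i : nat) : R :=
  if (0 < n)%N && (i < 2 * n)%N then 4%:R * X%:R / n%:R + 3%:R else 0.
have keyE x : x \in S -> forall s (n : 'I_X.+1) (i : 'I_(2 * X).+1),
    key x = (s, (n, i)) -> [/\ sx x = s, nx x = n & ix x = i].
  move=> /hS[lx hn _ _] s n i [<- <- <-]; have [/andP[_ hi] _ _ _] := level_data lx.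
  by split=> //; rewrite inordK //; lia.
apply: (@le_trans _ _ (\sum_(j : bool * ('I_X.+1 * 'I_(2 * X).+1)) bound j.2.1 j.2.2)).
  rewrite -sum1_size (partition_big key xpredT) //= natr_sum; apply: ler_sum.
  move=> -[s [n i]] _; rewrite sum1_count -size_filter.
  apply: (@thin_fiber_count _ X s n i); first by rewrite filter_uniq.
  move=> x; rewrite mem_filter => /andP[/eqP kx xS].
  have [e1 e2 e3] := keyE x xS _ _ _ kx; have [lx _ h1 h2] := hS x xS.
  by split.
rewrite [leLHS](_ : _ = \sum_(s : bool) \sum_(ni : 'I_X.+1 * 'I_(2 * X).+1)
  bound ni.1 ni.2); last by rewrite pair_bigA.
rewrite sumr_const card_bool.
rewrite -(pair_bigA _ (fun (n : 'I_X.+1) (i : 'I_(2 * X).+1) => bound n i)) /=.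
have : \sum_(n < X.+1) \sum_(i < (2 * X).+1) bound n i <= \sum_(n < X.+1) 14%:R * X%:R.
  apply: ler_sum => n _; have [n0|n0] := posnP (n : nat).
    by rewrite big1 ?mulr_ge0 // => i _; rewrite /bound n0.
  have nX : (2 * n <= (2 * X).+1)%N by have := ltn_ord n; lia.
  rewrite /bound n0 /= -big_mkcond /=.
  rewrite -(big_ord_widen _ (fun=> 4%:R * X%:R / n%:R + 3%:R) nX) sumr_const card_ord.
  have nR : 0 < n%:R :> R by rewrite ltr0n.
  have nXR : n%:R <= X%:R :> R by rewrite ler_nat -ltnS.
  rewrite -[leLHS]mulr_natl natrM mulrDr.
  rewrite (_ : 2%:R * n%:R * (4%:R * X%:R / n%:R) = 8%:R * X%:R); last first.
    by field; rewrite gt_eqF.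
  by lra.
rewrite sumr_const card_ord -[_ *+ X.+1]mulr_natl -natr1 mulr2n expr2 => h.
have : X%:R <= X%:R * X%:R :> R by rewrite ler_peMr //; lra.
move: h; rewrite mulrDl mul1r mulrCA.
by move: (X%:R * X%:R) (bigop _ _ _) => A1 A2; lra.
Qed.

Lemma level_opp x : qform a x = qform a v0 -> qform a (- x) = qform a v0.
Proof. by move=> <-; rewrite -scaleN1r qformZ sqrrN expr1n mul1r. Qed.

Lemma level_seq_opp S T x : level_seq S T -> (- x \in S) = (x \in S).
Proof.
move=> [_ hS].
have key y : y \in S -> - y \in S.
  move=> /hS[ly Ny]; apply/hS; split; first exact: level_opp.
  by rewrite /int_vec map_mxN is_normN.
by apply/idP/idP => [/key|/key //]; rewrite opprK.
Qed.

Lemma nat_le_sqrt_cofactor (c : R) (X m l : nat) (T : R) : 0 < c -> (0 < X)%N ->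
  T < X.+1%:R ^+ 2 -> (X < l)%N -> m%:R * l%:R <= 2%:R * (T / c) ->
  m%:R <= 4%:R / c * X%:R.
Proof.
move=> c0 X0 hT Xl h.
have lR : 0 < l%:R :> R by rewrite ltr0n; lia.
have XlR : X.+1%:R <= l%:R :> R by rewrite ler_nat.
have X2 : X.+1%:R <= 2%:R * X%:R :> R by rewrite -natrM ler_nat; lia.
have XR : 0 <= X.+1%:R :> R by [].
rewrite -(ler_pM2r (_ : 0 < X.+1%:R)) ?ltr0n //.
apply: le_trans (_ : m%:R * l%:R <= _); first by rewrite ler_wpM2l.
apply: le_trans h _.
apply: le_trans (_ : 2%:R * (X.+1%:R ^+ 2 / c) <= _).
  by rewrite ler_pM2l // ler_pM2r ?invr_gt0 // ltW.
rewrite (_ : 2%:R * (X.+1%:R ^+ 2 / c) = 2%:R / c * X.+1%:R * X.+1%:R); last by ring.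
rewrite ler_wpM2r //.
rewrite (_ : 4%:R / c * X%:R = 2%:R / c * (2%:R * X%:R)); last by ring.
by rewrite ler_wpM2l // divr_ge0 // ltW.
Qed.

(** By [represents_opp] the height of -x is |u| up to a factor between 1 and D.
    If both heights are at most X, so is |p|, and |u| is at most D X.  If both
    exceed X, then |p| and |u| are at least X + 1 > sqrt T, while |p| |u| = O(T)
    bounds each by a multiple of X. *)
Lemma height_duality : exists C : nat, forall S T X x, (0 < X)%N -> level_seq S T ->
  T < X.+1%:R ^+ 2 -> x \in S -> (nx x <= X)%N = (nx (- x)%R <= X)%N ->
  [/\ (nx x <= C * X)%N, `|u1x x| <= (C * X)%N%:Z & `|u2x x| <= (C * X)%N%:Z].
Proof.
have [c c0 hc] := is_norm_coercive is_norm_frame.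
(* The summands serve the cases of two small and of two large heights. *)
exists (absz D + (Num.trunc (4%:R / c)).+1)%N; set C := (_ + _)%N.
move=> S T X x X0 hST hT xS hn; have [_ hS] := hST.
have [lx NT] := (hS x).1 xS.
have r := level_data lx; have r' := level_data (level_opp lx).
have [l [l0 lD e1 e2]] := represents_opp D0 dEFG r r'.
have [/andP[_ hi] _ _ _] := r; have [/andP[_ hi'] _ _ _] := r'.
have [nX|nX] := leqP (nx x) X.
  have {}hn : (nx (- x) <= X)%N by rewrite -hn.
  move: hi' hn lD e1 e2; set q1 := sector1 _ _ _; set q2 := sector2 _ _ _ => hi' hn lD e1 e2.
  have q1X : `|q1| <= X%:Z by move: hi' hn; rewrite /q1 /sector1; case: (sx _); move: (nx _) (ix _) => y z; lia.
  have q2X : `|q2| <= X%:Z by move: hi' hn; rewrite /q2 /sector2; case: (sx _); move: (nx _) (ix _) => y z; lia.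
  rewrite e1 e2 /C !normrM; split; first by nia.
  - by apply: le_trans (ler_pM _ _ lD q1X) _ => //; nia.
  - by apply: le_trans (ler_pM _ _ lD q2X) _ => //; nia.
have nX' : (X < nx (- x))%N by rewrite ltnNge -hn -ltnNge.
have small (m : nat) : m%:R <= 4%:R / c * X%:R -> (m <= C * X)%N.
  rewrite -(ler_nat R) => h; apply: le_trans h _; rewrite natrM ler_wpM2r //.
  have := truncnS_gt (4%:R / c) => h; apply: le_trans (ltW h) _.
  by rewrite ler_nat leq_addl.
rewrite (norm_represents r) in NT.
have entry := hc (sym_prod (sector1 (sx x) (nx x) (ix x))%:~R
  (sector2 (sx x) (nx x) (ix x))%:~R (u1x x)%:~R (u2x x)%:~R).
have m11 : `|(sector1 (sx x) (nx x) (ix x))%:~R * (u1x x)%:~R| <= T / c.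
  by rewrite ler_pdivlMr // mulrC; have := entry 0; rewrite vec3E => h; apply: le_trans h (ltW _).
have m22 : `|(sector2 (sx x) (nx x) (ix x))%:~R * (u2x x)%:~R| <= T / c.
  by rewrite ler_pdivlMr // mulrC; have := entry 1; rewrite vec3E => h; apply: le_trans h (ltW _).
have m12 : `|(sector1 (sx x) (nx x) (ix x))%:~R * (u2x x)%:~R
     + (sector2 (sx x) (nx x) (ix x))%:~R * (u1x x)%:~R| <= T / c.
  by rewrite ler_pdivlMr // mulrC; have := entry 2%:R; rewrite vec3E => h; apply: le_trans h (ltW _).
have [b12 b21] := sym_prod_entries_bound m11 m22 m12.
have T0 : 0 <= T / c by apply: le_trans m11.
have T2 : T / c <= 2%:R * (T / c) by lra.
have b11 := le_trans m11 T2; have b22 := le_trans m22 T2.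
have nu1 : (nx x)%:R * (absz (u1x x))%:R <= 2%:R * (T / c).
  move: b11 b21; rewrite /sector1 /sector2; case: (sx x) => h1 h2.
    by rewrite natr_absz intr_norm -[(nx x)%:R]ger0_norm // -normrM.
  by rewrite natr_absz intr_norm -[(nx x)%:R]ger0_norm // -normrM.
have nu2 : (nx x)%:R * (absz (u2x x))%:R <= 2%:R * (T / c).
  move: b12 b22; rewrite /sector1 /sector2; case: (sx x) => h1 h2.
    by rewrite natr_absz intr_norm -[(nx x)%:R]ger0_norm // -normrM.
  by rewrite natr_absz intr_norm -[(nx x)%:R]ger0_norm // -normrM.
have big_u : (X < absz (u1x x))%N \/ (X < absz (u2x x))%N.
  have l1 : (0 < absz l)%N by rewrite absz_gt0.
  rewrite e1 e2 /sector1 /sector2.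
  by case: (sx (- x)); [left|right]; rewrite abszM (leq_trans nX') // leq_pmull.
have u1C : (absz (u1x x) <= C * X)%N.
  by apply: small; apply: (nat_le_sqrt_cofactor c0 X0 hT nX); rewrite mulrC.
have u2C : (absz (u2x x) <= C * X)%N.
  by apply: small; apply: (nat_le_sqrt_cofactor c0 X0 hT nX); rewrite mulrC.
split; [|by rewrite -abszE lez_nat|by rewrite -abszE lez_nat].
by apply: small; case: big_u => h; [exact: (nat_le_sqrt_cofactor c0 X0 hT h nu1)
  |exact: (nat_le_sqrt_cofactor c0 X0 hT h nu2)].
Qed.

(** The points x with nx x <= X and those with nx (- x) <= X are equally many,
    and all the points but the thin ones belong to exactly one of the two
    sets. *)
Lemma level_count : exists2 c, 0 < c & exists C, forall S T X, (0 < X)%N ->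
  X%:R ^+ 2 <= T < X.+1%:R ^+ 2 -> level_seq S T ->
  `|(size S)%:R - c * T * ln X%:R| <= C * T.
Proof.
have [c c0 [C1 hC1]] := small_height_count; have [C hC] := height_duality.
have KR : 0 < K%:R :> R by rewrite ltr0n.
exists (4%:R / K%:R * c); first by rewrite mulr_gt0 // divr_gt0.
exists (2%:R * (`|C1| * 2%:R) + 56%:R * C.+1%:R ^+ 2) => S T X X0 /andP[XT TX] hST.
have XR : 0 < X%:R :> R by rewrite ltr0n.
have T0 : 0 < T by apply: lt_le_trans XT; rewrite exprn_gt0.
pose low x := (nx x <= X)%N.
have [uS hS] := hST.
have opp_count : count (fun x => low (- x)) S = count low S.
  rewrite -[LHS](count_map (-%R) low); apply/permP; apply: uniq_perm => //.
    by rewrite map_inj_uniq //; exact: oppr_inj.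
  move=> x; rewrite -(level_seq_opp x hST); apply/mapP/idP => [[y yS ->]|xS].
    by rewrite opprK.
  by exists (- x) => //; rewrite opprK.
pose thin := [seq x <- S | low x == low (- x)].
have thin_le : (size thin)%:R <= 56%:R * C.+1%:R ^+ 2 * T :> R.
  have h := @thin_count thin (C.+1 * X)%N (filter_uniq _ uS).
  apply: le_trans (h _ _) _; first by rewrite muln_gt0.
    move=> x; rewrite mem_filter => /andP[/eqP hx xS].
    have [h1 h2 h3] := hC S T X x X0 hST TX xS hx; have [lx _] := (hS x).1 xS.
    have CX : (C * X <= C.+1 * X)%N by rewrite leq_mul2r leqnSn orbT.
    split; [exact: lx|exact: leq_trans h1 CX|..].
      by apply: le_trans h2 _; rewrite lez_nat.
    by apply: le_trans h3 _; rewrite lez_nat.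
  by rewrite natrM exprMn mulrA ler_wpM2l // mulr_ge0 // exprn_ge0.
have diff : `|(size S)%:R - 2%:R * (count low S)%:R| <= (size thin)%:R :> R.
  have [E1 E2] : ((size S)%:Z - 2%:Z * (count low S)%:Z <= (size thin)%:Z)%R /\
      (2%:Z * (count low S)%:Z - (size S)%:Z <= (size thin)%:Z)%R.
    rewrite /thin size_filter.
    have := count_agree low (fun x => low (- x)) S; rewrite opp_count.
    by move: (size S) (count low S) (count _ S) => A1 A2 A3; lia.
  rewrite ler_norml; apply/andP; split.
    by move: E2; rewrite -(ler_int R) intrB intrM -!pmulrn; lra.
  by move: E1; rewrite -(ler_int R) intrB intrM -!pmulrn; lra.
have h1 := hC1 S T X T0 X0 hST; rewrite -/low in h1.
rewrite (_ : _ - _ = ((size S)%:R - 2%:R * (count low S)%:R)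
   + 2%:R * ((count low S)%:R - 2%:R * T / K%:R * (c * ln X%:R))); last first.
  by rewrite -[4%:R]/((2 * 2)%:R) natrM; ring.
apply: le_trans (ler_normD _ _) _; rewrite [leLHS]addrC [leRHS]mulrDl; apply: lerD; last first.
  exact: le_trans diff thin_le.
rewrite normrM [X in X * _]ger0_norm // -[leRHS]mulrA ler_wpM2l //; apply: le_trans h1 _.
apply: le_trans (_ : `|C1| * (X%:R ^+ 2 + T) <= _).
  by rewrite ler_wpM2r ?ler_norm // addr_ge0 // ?exprn_ge0 // ltW.
by rewrite -[leRHS]mulrA ler_wpM2l //; lra.
Qed.

End WithData.
End Count.

(** * The asymptotic formula *)

Lemma finite_bounded_int_vectors (B : nat) :
  finite_set [set x : 'cV[int]_3 | forall i, `|x i 0| <= B%:Z].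
Proof.
pose f (h : {ffun 'I_3 -> 'I_(2 * B).+1}) : 'cV[int]_3 := \col_i ((h i)%:Z - B%:Z).
apply: (@sub_finite_set _ _ (f @` setT)); last exact/finite_image/finite_finset.
move=> x /= hx; exists [ffun i => inord (absz (x i 0 + B%:Z))] => //.
apply/matrixP => i j; rewrite (ord1 j) mxE ffunE inordK; have := hx i; lia.
Qed.

Lemma finite_level_points (R : realType) a v0 (N : 'cV[R]_3 -> R) (T : R) :
  is_norm N -> finite_set (level_points a v0 N T).
Proof.
move=> normN; have [c c0 hc] := is_norm_coercive normN.
apply: sub_finite_set (finite_bounded_int_vectors (Num.trunc (T / c)).+1) => x [_ NT] i.
have := hc (int_vec R x) i; rewrite mxE -intr_norm => h.
rewrite -(ler_int R); apply: ltW; apply: le_lt_trans (truncnS_gt (T / c)).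
by rewrite ler_pdivlMr // mulrC ltW // (le_lt_trans h).
Qed.

Lemma level_seq_level_points (R : realType) a v0 (N : 'cV[R]_3 -> R) (T : R) :
  is_norm N -> level_seq a v0 N (fset_set (level_points a v0 N T)) T.
Proof.
move=> normN; split; first exact: fset_uniq.
move=> x; rewrite in_fset_set; last exact: finite_level_points.
by split; [move=> /set_mem|move=> h; apply/mem_set].
Qed.

Lemma level_represents (a : 'M[int]_3) (v0 E F G : 'cV[int]_3) (K : nat) (M : int) x :
  0 < M ->
  (forall x, qform a x = qform a v0 -> exists X Y Z,
    Z ^+ 2 - X * Y = M ^+ 2 /\ K%:Z *: x = X *: E + Y *: F + (2%:R * Z) *: G) ->
  qform a x = qform a v0 ->
  exists s n i u1 u2, represents E F G K (2%:R * M) x s n i u1 u2.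
Proof.
move=> M0 hx /hx[X [Y [Z [hZ hK]]]].
have Mn : M != 0 by rewrite gt_eqF.
have [p1 [p2 [u1 [u2 [[b [c hbc]] h11 h22 h12 h21]]]]] := rank_one_factorization Mn hZ.
have [e [s [n [i [e2 ni0 ni q1 q2]]]]] := sector_normal_form hbc.
have ee : e * e = 1 by rewrite -expr2.
exists s, n, i, (e * u1), (e * u2); split=> //.
  rewrite (_ : _ - _ = p1 * u2 - p2 * u1); first by rewrite h12 h21; ring.
  by rewrite q1 q2; ring.
rewrite hK cols3M !mxE /= -h11 -h22 (_ : 2%:R * Z = p1 * u2 + p2 * u1).
  by rewrite q1 q2; congr (_ *: _ + _ *: _ + _ *: _); ring.
by rewrite h12 h21; ring.
Qed.

Lemma represents_level (a : 'M[int]_3) (v0 E F G : 'cV[int]_3) (K : nat) (M : int)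
    x s n i u1 u2 :
  (forall x X Y W, K%:Z *: x = X *: E + Y *: F + W *: G ->
    W ^+ 2 - 4%:R * X * Y = (2%:R * M) ^+ 2 -> qform a x = qform a v0) ->
  represents E F G K (2%:R * M) x s n i u1 u2 -> qform a x = qform a v0.
Proof.
move=> hx [_ _ hD]; rewrite cols3M !mxE /= => h.
by apply: (hx _ _ _ _ h); rewrite -hD; ring.
Qed.

(** X^2 <= T < 4 X^2. *)
Lemma ln_trunc_sqrt (R : realType) (T : R) (X : nat) : (0 < X)%N ->
  X%:R ^+ 2 <= T < X.+1%:R ^+ 2 -> `|ln X%:R - ln T / 2%:R| <= 1.
Proof.
move=> X0 /andP[h1 h2]; have XR : 0 < X%:R :> R by rewrite ltr0n.
have T0 : 0 < T by apply: lt_le_trans h1; rewrite exprn_gt0.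
have l1 : ln X%:R *+ 2 <= ln T by rewrite -lnXn // ler_ln ?posrE ?exprn_gt0.
have l2 : ln T <= ln ((2%:R * X%:R) ^+ 2).
  rewrite ler_ln ?posrE ?exprn_gt0 ?mulr_gt0 //; apply: le_trans (ltW h2) _.
  by rewrite ler_pXn2r ?nnegrE ?mulr_ge0 // -natrM ler_nat; lia.
have l3 : ln 2%:R <= 1 :> R.
  by have := @le_ln1Dx R 1; rewrite (_ : 1 + 1 = 2%:R) //; apply; lra.
move: l2; rewrite lnXn ?mulr_gt0 // lnM ?posrE // mulr2n => l2.
move: l1 l2 l3; rewrite mulr2n; move: (ln X%:R) (ln T) (ln 2%:R) => x t z l1 l2 l3.
by rewrite ler_norml; apply/andP; split; lra.
Qed.

Lemma asymptotic_of_bound (R : realType) (f : R -> R) (c C : R) : 0 < c ->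
  (forall T, 4%:R <= T -> `|f T - c * (T * ln T)| <= C * T) ->
  f T / (c * (T * ln T)) @[T --> +oo] --> (1 : R).
Proof.
move=> c0 hf; apply/cvgrPdist_lt => e e0.
near=> T.
have T4 : 4%:R <= T by near: T; exact: nbhs_pinfty_ge.
have T0 : 0 < T by apply: lt_le_trans T4.
have hln : `|C| / (c * e) < ln T.
  rewrite -ltr_expR lnK ?posrE //; near: T; exact: nbhs_pinfty_gt.
have ln0 : 0 < ln T by apply: le_lt_trans hln; rewrite divr_ge0 // mulr_ge0 // ltW.
have d0 : 0 < c * (T * ln T) by rewrite !mulr_gt0.
rewrite (_ : 1 - _ = - ((f T - c * (T * ln T)) / (c * (T * ln T)))); last first.
  by field; rewrite !gt_eqF.
rewrite normrN normrM normfV (gtr0_norm d0) ltr_pdivrMr //.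
apply: le_lt_trans (hf T T4) _.
apply: le_lt_trans (_ : `|C| * T < _); first by rewrite ler_wpM2r ?ler_norm // ltW.
move: hln; rewrite ltr_pdivrMr ?mulr_gt0 // => h.
rewrite (_ : e * _ = ln T * (c * e) * T); last by ring.
by rewrite ltr_pM2r.
Unshelve. all: by end_near.
Qed.

Theorem corollary1p4 (R : realType) (a : 'M[int]_3) (N : 'cV[R]_3 -> R)
    (v0 : 'cV[int]_3) :
  signature_2_1 R a ->
  is_norm N ->
  0 < qform a v0 ->
  Q_isotropic (stabilizer a v0) ->
  exists2 c : R, 0 < c &
    (count_points a v0 N T)%:R / (c * (T * ln T)) @[T --> +oo] --> (1 : R).
Proof.
move=> sgn normN m0 iso.
have [E [F [G [K [M [[K0 M0] toL fromL base dEFG]]]]]] := hyperbolic_parametrization sgn m0 iso.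
have D0 : 0 < 2%:R * M by rewrite mulr_gt0.
case: K K0 toL fromL base => [[|K']|//] // _ toL fromL base.
have lr x : qform a x = qform a v0 ->
    exists s n i u1 u2, represents E F G K'.+1 (2%:R * M) x s n i u1 u2.
  exact: level_represents.
have rl x s n i u1 u2 : represents E F G K'.+1 (2%:R * M) x s n i u1 u2 ->
    qform a x = qform a v0.
  exact: represents_level.
have bp : represents E F G K'.+1 (2%:R * M) v0 true 1 1 0 (2%:R * M).
  split=> //; rewrite /sector1 /sector2; first by ring.
  by rewrite base cols3M !mxE /= subrr !mulr0 !mul0r !scale0r !add0r addr0 mul1r.
have [sx [nx [ix [u1x [u2x data]]]]] := representation_data lr.
have [c c0 [C hC]] := level_count normN D0 dEFG rl data bp.
exists (c / 2%:R); first by rewrite divr_gt0.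
apply: (@asymptotic_of_bound _ _ _ (C + c)); first by rewrite divr_gt0.
move=> T T4; have T0 : 0 <= T by apply: le_trans T4.
pose X := Num.trunc (Num.sqrt T).
have /andP[X1 X2] := truncn_itv (sqrtr_ge0 T); rewrite -/X in X1 X2.
have X0 : (0 < X)%N.
  rewrite truncn_gt0 -sqrtr1 ler_wsqrtr //.
  by apply: le_trans T4; rewrite ler1n.
have XT : X%:R ^+ 2 <= T < X.+1%:R ^+ 2.
  rewrite -{1 2}(sqr_sqrtr T0) ler_pXn2r ?nnegrE ?sqrtr_ge0 //.
  by rewrite ltr_pXn2r ?nnegrE ?sqrtr_ge0 // X1 X2.
have := hC _ T X X0 XT (level_seq_level_points a v0 T normN).
have hln := ln_trunc_sqrt X0 XT; rewrite -/(count_points a v0 N T) => h.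
rewrite (_ : _ - _ = ((count_points a v0 N T)%:R - c * T * ln X%:R)
   + c * T * (ln X%:R - ln T / 2%:R)); last by field.
apply: le_trans (ler_normD _ _) _; rewrite mulrDl; apply: lerD => //.
by rewrite normrM ger0_norm ?mulr_ge0 ?(ltW c0) // -[leRHS]mulr1 ler_wpM2l // mulr_ge0 // ltW.
Qed.
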